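(* Let $n\ge 1$ and let $\mathbb K$ be a field. The elements $T_{\le\Sigma_\alpha}$ for $\alpha\vDash_e n$ (indexed by the maximal compositions $\alpha$ of $n$) form a $\mathbb K$-basis of the center $Z(H_n(0))$ of the $0$-Hecke algebra $H_n(0)$ of $\mathfrak S_n$ over $\mathbb K$.
   Context: $\mathfrak S_n$ is the symmetric group on $[n]=\{1,\dots,n\}$ (products are compositions of functions), with Coxeter generators $s_i=(i,i+1)$, $1\le i\le n-1$, and Coxeter length function $\ell$ (number of inversions). The Bruhat order $\le$ on $\mathfrak S_n$: $u\le w$ if some reduced word of $w$ contains a reduced word of $u$ as a subsequence. The $0$-Hecke algebra $H_n(0)$ is the unital associative $\mathbb K$-algebra generated by $T_1,\dots,T_{n-1}$ subject to $T_i^2=-T_i$, $T_iT_{i+1}T_i=T_{i+1}T_iT_{i+1}$, and $T_iT_j=T_jT_i$ for $|i-j|\ge2$. For $w\in\mathfrak S_n$ with reduced word $s_{i_1}\cdots s_{i_r}$ put $T_w=T_{i_1}\cdots T_{i_r}$ (well defined); $\{T_w\mid w\in\mathfrak S_n\}$ is a $\mathbb K$-basis of $H_n(0)$. For a subset $\Sigma\subseteq\mathfrak S_n$ put $T_{\le\Sigma}=\sum_x T_x$, where $x$ runs over all $x\in\mathfrak S_n$ with $x\le w$ for some $w\in\Sigma$. Relation $\approx$: write $w\overset{s_i}{\to}w'$ if $w'=s_iws_i$ and $\ell(w')\le\ell(w)$. Let $\to$ be the reflexive and transitive closure of the union of the relations $\overset{s_i}{\to}$. Write $w\approx w'$ if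 $w\to w'$ and $w'\to w$; this is an equivalence relation on $\mathfrak S_n$. A composition $\alpha=(\alpha_1,\dots,\alpha_l)$ of $n$ (finite sequence of positive integers with sum $n$) is called maximal, written $\alpha\vDash_e n$, if there is $0\le k\le l$ such that $\alpha_i$ is even for $i\le k$, $\alpha_i$ is odd for $i>k$, and $\alpha_{k+1}\ge\dots\ge\alpha_l$. Element in stair form: let $(x_1,\dots,x_n)$ be the list with $x_{2i-1}=i$ and $x_{2i}=n-i+1$. For a composition $\alpha=(\alpha_1,\dots,\alpha_l)$ of $n$, $\sigma_\alpha\in\mathfrak S_n$ is the product of the disjoint cycles $(x_{\alpha_1+\dots+\alpha_{i-1}+1},\dots,x_{\alpha_1+\dots+\alpha_{i-1}+\alpha_i})$ for $i=1,\dots,l$. For $\alpha\vDash_e n$, $\Sigma_\alpha$ denotes the $\approx$-equivalence class of $\sigma_\alpha$. *)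

(* Defs.v *)
From HB Require Import structures.
From mathcomp Require Import all_boot all_fingroup all_algebra.
From mathcomp Require Import generic_quotient ring_quotient boolp.
From mathcomp Require Import finmap monalg.

Set Implicit Arguments.
Unset Strict Implicit.
Unset Printing Implicit Defensive.

Import GRing.Theory.
Local Open Scope ring_scope.
Local Open Scope quotient_scope.

Definition two_sided_ideal (R : nzRingType) (I : R -> Prop) : Prop :=
  [/\ I 0, forall x y, I x -> I y -> I (x - y),
      forall a x, I x -> I (a * x) & forall a x, I x -> I (x * a)].

Definition ideal_gen (R : nzRingType) (S : R -> Prop) (x : R) : Prop :=
  forall I : R -> Prop, two_sided_ideal I -> (forall y, S y -> I y) -> I x.

Lemma ideal_gen_ideal (R : nzRingType) (S : R -> Prop) :
  two_sided_ideal (ideal_gen S).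
Proof.
split=> [I [] //|x y Ix Iy I idI SI|a x Ix I idI SI|a x Ix I idI SI];
  have [_ IB IMl IMr] := idI.
- by apply: IB; [apply: Ix|apply: Iy].
- by apply: IMl; apply: Ix.
- by apply: IMr; apply: Ix.
Qed.

Definition ideal_pred (R : nzRingType) (S : R -> Prop) : pred R :=
  fun x => `[< ideal_gen S x >].

Lemma ideal_pred_zmod (R : nzRingType) (S : R -> Prop) :
  zmod_closed (ideal_pred S).
Proof.
have [I0 IB _ _] := ideal_gen_ideal S.
split=> [|x y]; rewrite ?unfold_in; first exact/asboolP.
by move=> /asboolP Ix /asboolP Iy; apply/asboolP; apply: (IB _ _ Ix Iy).
Qed.

HB.instance Definition _ (R : nzRingType) (S : R -> Prop) :=
  GRing.isZmodClosed.Build R (ideal_pred S) (ideal_pred_zmod S).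

Definition ideal_closed (R : nzRingType) (S : R -> Prop) : zmodClosed R :=
  GRing.ZmodClosed.clone R (ideal_pred S) _.

(* Indices are shifted to start from 0: i : 'I_n.-1 stands for the generator *)
(* with index i.+1 in {1, ..., n-1}, and 'I_n for {1, ..., n}. The monoid    *)
(* algebra of the free monoid on n-1 letters is the free unital algebra.     *)
Definition free_alg (K : fieldType) (n : nat) := {malg K[{fmonom 'I_n.-1}]}.
HB.instance Definition _ K n := GRing.Lalgebra.on (free_alg K n).

Definition fgen (K : fieldType) n (i : 'I_n.-1) : free_alg K n :=
  mkmalgU (fmu i) 1.

Inductive hecke_relator (K : fieldType) (n : nat) : free_alg K n -> Prop :=
| HeckeQuad (i : 'I_n.-1) :
    hecke_relator (fgen K i * fgen K i + fgen K i)
| HeckeBraid (i j : 'I_n.-1) : j = i.+1 :> nat ->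
    hecke_relator (fgen K i * fgen K j * fgen K i
                   - fgen K j * fgen K i * fgen K j)
| HeckeComm (i j : 'I_n.-1) : (i.+1 < j)%N || (j.+1 < i)%N ->
    hecke_relator (fgen K i * fgen K j - fgen K j * fgen K i).

Definition hecke0 (K : fieldType) (n : nat) : Type :=
  @Quotient.quot (free_alg K n) (ideal_closed (@hecke_relator K n)).

Section HeckeAlgebra.
Variables (K : fieldType) (n : nat).
Local Notation F := (free_alg K n).
Local Notation S := (@hecke_relator K n).
Local Notation H := (hecke0 K n).

HB.instance Definition _ := GRing.Zmodule.on H.
HB.instance Definition _ := EqQuotient.on H.

Lemma free_alg_scalerAr (k : K) (x y : F) : k *: (x * y) = x * (k *: y).
Proof.
rewrite !malgM_def fgmulr (fgmulrw (fsubset_refl _) (msuppZ_le k y)).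
rewrite scaler_sumr; apply: eq_bigr => k2 _.
rewrite scaler_sumr; apply: eq_bigr => k1 _.
by apply/malgP => m; rewrite mcoeffZ !mcoeffU mcoeffZ mulrnAr mulrCA.
Qed.

Lemma hecke_pi_eq (x y : F) : \pi_H x = \pi_H y <-> ideal_gen S (x - y).
Proof.
have E := Quotient.idealrBE (ideal_closed S) x y.
rewrite unfold_in in E.
by split=> [/eqP|/asboolP]; [rewrite -E => /asboolP|rewrite E => /eqP].
Qed.

Lemma hecke_reprK (x : F) : ideal_gen S (repr (\pi_H x) - x).
Proof. by apply/hecke_pi_eq; rewrite reprK. Qed.

Lemma hecke_piD (x y : F) : \pi_H (x + y) = \pi_H x + \pi_H y.
Proof. by rewrite !piE. Qed.

Definition hecke_one : H := \pi_H 1.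
Definition hecke_mul (x y : H) : H := \pi_H (repr x * repr y).
Definition hecke_scale (k : K) (x : H) : H := \pi_H (k *: repr x).

Lemma hecke_pi_mul (x y : F) : hecke_mul (\pi_H x) (\pi_H y) = \pi_H (x * y).
Proof.
have [I0 IB IMl IMr] := ideal_gen_ideal S.
apply/hecke_pi_eq; set x' := repr _; set y' := repr _.
have -> : x' * y' - x * y = (x' - x) * y' - x * (y - y').
  by rewrite mulrBl mulrBr opprB addrA subrK.
apply: (IB); first by apply: IMr; exact: hecke_reprK.
apply: IMl; rewrite -opprB -sub0r; apply: (IB) => //; exact: hecke_reprK.
Qed.

Lemma hecke_pi_scale (k : K) (x : F) : hecke_scale k (\pi_H x) = \pi_H (k *: x).
Proof.
have [_ _ IMl _] := ideal_gen_ideal S.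
apply/hecke_pi_eq; rewrite -scalerBr -mulr_algl.
by apply: IMl; exact: hecke_reprK.
Qed.

Let lift1 (P : H -> Prop) : (forall x, P (\pi_H x)) -> forall x, P x.
Proof. by move=> Ppi x; rewrite -[x]reprK. Qed.

Lemma hecke_mulA : associative hecke_mul.
Proof.
elim/lift1=> x; elim/lift1=> y; elim/lift1=> z.
by rewrite !hecke_pi_mul mulrA.
Qed.

Lemma hecke_mul1l : left_id hecke_one hecke_mul.
Proof. by elim/lift1=> x; rewrite hecke_pi_mul mul1r. Qed.

Lemma hecke_mul1r : right_id hecke_one hecke_mul.
Proof. by elim/lift1=> x; rewrite hecke_pi_mul mulr1. Qed.

Lemma hecke_mulDl : left_distributive hecke_mul +%R.
Proof.
elim/lift1=> x; elim/lift1=> y; elim/lift1=> z.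
by rewrite -hecke_piD !hecke_pi_mul mulrDl hecke_piD.
Qed.

Lemma hecke_mulDr : right_distributive hecke_mul +%R.
Proof.
elim/lift1=> x; elim/lift1=> y; elim/lift1=> z.
by rewrite -hecke_piD !hecke_pi_mul mulrDr hecke_piD.
Qed.

(* The constant coefficient is a ring morphism F -> K killing the relators. *)
Lemma hecke_one_neq0 : hecke_one != 0.
Proof.
have [aug [aug_gen aug1 augB augD augM]] : exists aug : F -> K,
    [/\ forall i, aug (fgen K i) = 0, aug 1 = 1,
        {morph aug : x y / x - y}, {morph aug : x y / x + y}
      & {morph aug : x y / x * y}].
  pose aug := GRing.RMorphism.clone {malg K[{fmonom 'I_n.-1}]} K (mcoeff mone) _.
  exists aug; split; last exact: (rmorphM aug).
  - by move=> i; rewrite /aug /= mcoeffU -fdeg_eq0 fdegU.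
  - exact: (rmorph1 aug).
  - exact: (rmorphB aug).
  - exact: (rmorphD aug).
have aug_genr x i : aug (x * fgen K i) = 0 by rewrite augM aug_gen mulr0.
have aug0B x y : aug x = 0 -> aug y = 0 -> aug (x - y) = 0.
  by move=> x0 y0; rewrite augB x0 y0 subr0.
have aug0 : aug 0 = 0 by rewrite -(subrr 0) augB subrr.
pose I (x : F) := aug x = 0.
have idI : two_sided_ideal I.
  split=> [|x y Ix Iy|a x Ix|a x Ix]; rewrite /I //.
  - exact: aug0B.
  - by rewrite augM Ix mulr0.
  - by rewrite augM Ix mul0r.
apply/eqP => pi1; have : \pi_H 1 = \pi_H 0 by rewrite -/hecke_one pi1 piE.
move/hecke_pi_eq; rewrite subr0 => /(_ I idI) I1.
have /eqP : I 1.
  apply: I1 => _ [i|i j _|i j _]; rewrite /I.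
  - by rewrite augD aug_genr aug_gen addr0.
  - by apply: aug0B; exact: aug_genr.
  - by apply: aug0B; exact: aug_genr.
by rewrite aug1 oner_eq0.
Qed.

HB.instance Definition _ := GRing.Zmodule_isNzRing.Build H
  hecke_mulA hecke_mul1l hecke_mul1r hecke_mulDl hecke_mulDr hecke_one_neq0.

Lemma hecke_scaleA (a b : K) (x : H) :
  hecke_scale a (hecke_scale b x) = hecke_scale (a * b) x.
Proof. by elim/lift1: x => x; rewrite !hecke_pi_scale scalerA. Qed.

Lemma hecke_scale1 : left_id 1 hecke_scale.
Proof. by elim/lift1=> x; rewrite hecke_pi_scale scale1r. Qed.

Lemma hecke_scaleDr : right_distributive hecke_scale +%R.
Proof.
move=> a; elim/lift1=> x; elim/lift1=> y.
by rewrite -hecke_piD !hecke_pi_scale scalerDr hecke_piD.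
Qed.

Lemma hecke_scaleDl (x : H) : {morph hecke_scale^~ x : a b / a + b}.
Proof.
by elim/lift1: x => x a b; rewrite !hecke_pi_scale scalerDl hecke_piD.
Qed.

HB.instance Definition _ := GRing.Zmodule_isLmodule.Build K H
  hecke_scaleA hecke_scale1 hecke_scaleDr hecke_scaleDl.

Lemma hecke_scaleAl (k : K) (x y : H) :
  hecke_scale k (hecke_mul x y) = hecke_mul (hecke_scale k x) y.
Proof.
elim/lift1: x => x; elim/lift1: y => y.
by rewrite hecke_pi_mul !hecke_pi_scale hecke_pi_mul scalerAl.
Qed.

HB.instance Definition _ := GRing.Lmodule_isLalgebra.Build K H hecke_scaleAl.

Lemma hecke_scaleAr (k : K) (x y : H) :
  hecke_scale k (hecke_mul x y) = hecke_mul x (hecke_scale k y).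
Proof.
elim/lift1: x => x; elim/lift1: y => y.
by rewrite hecke_pi_mul !hecke_pi_scale hecke_pi_mul free_alg_scalerAr.
Qed.

HB.instance Definition _ := GRing.Lalgebra_isAlgebra.Build K H hecke_scaleAr.

End HeckeAlgebra.

Definition hecke_gen (K : fieldType) (n : nat) (i : 'I_n.-1) : hecke0 K n :=
  \pi_(hecke0 K n) (fgen K i).

Section SymmetricGroup.
Variable n : nat.
Implicit Types (u w : 'S_n) (r : seq 'I_n.-1).

(* The composite x |-> u (w x): the product of permutations in the library   *)
(* applies the left factor first.                                            *)
Definition comp_perm u w : 'S_n := (w * u)%g.

Lemma ord_succ_subproof (i : 'I_n.-1) : (i.+1 < n)%N.
Proof. by case: n i => [|m] [i]. Qed.

Definition cox_gen (i : 'I_n.-1) : 'S_n :=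
  tperm (Ordinal (ltnW (ord_succ_subproof i))) (Ordinal (ord_succ_subproof i)).

Definition cox_len w : nat :=
  #|[set p : 'I_n * 'I_n | (p.1 < p.2)%N && (w p.2 < w p.1)%N]|.

Definition word_perm r : 'S_n :=
  foldr (fun i w => comp_perm (cox_gen i) w) 1%g r.

Definition reduced_word w r : bool :=
  (word_perm r == w) && (size r == cox_len w).

Definition bruhat u w : bool :=
  [exists r : (cox_len w).-tuple 'I_n.-1,
    [exists q : (cox_len u).-tuple 'I_n.-1,
      [&& reduced_word w r, reduced_word u q & subseq q r]]].

Definition conj_step w w' : bool :=
  [exists i, (w' == comp_perm (cox_gen i) (comp_perm w (cox_gen i)))
             && (cox_len w' <= cox_len w)%N].

Definition approx w w' : bool := connect conj_step w w' && connect conj_step w' w.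

End SymmetricGroup.

(* Every permutation has a reduced word, so the default 0 never occurs, and  *)
(* by Matsumoto's theorem the result does not depend on the word picked.     *)
Definition hecke_T (K : fieldType) (n : nat) (w : 'S_n) : hecke0 K n :=
  if [pick r : (cox_len w).-tuple 'I_n.-1 | reduced_word w r] is Some r
  then \prod_(i <- r) hecke_gen K i else 0.

Definition hecke_T_le (K : fieldType) (n : nat) (Sigma : {set 'S_n}) :
    hecke0 K n :=
  \sum_(x : 'S_n | [exists w in Sigma, bruhat x w]) hecke_T K x.

Definition is_composition (n : nat) (a : seq nat) : bool :=
  all (fun x => 0 < x)%N a && (sumn a == n).

Definition maximal_parts (a : seq nat) : bool :=
  [exists k : 'I_(size a).+1,
    [&& all (fun x => ~~ odd x) (take k a), all odd (drop k a)
      & sorted geq (drop k a)]].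

Record max_composition (n : nat) := MaxComposition {
  max_parts :> seq nat;
  max_partsP : is_composition n max_parts && maximal_parts max_parts
}.

HB.instance Definition _ n := [isSub for @max_parts n].
HB.instance Definition _ n := [Countable of max_composition n by <:].

Section StairForm.
Variable n : nat.

Lemma half_subproof (k : 'I_n) : (k./2 < n)%N.
Proof.
apply: leq_ltn_trans (ltn_ord k).
by rewrite -{2}[k : nat]odd_double_half -addnn addnA leq_addl.
Qed.

(* With positions and values starting from 0, x_1, ..., x_n is the list      *)
(* 0, n-1, 1, n-2, ... ; rev_ord j has value n - 1 - j.                      *)
Definition stair_entry (k : 'I_n) : 'I_n :=
  let h := Ordinal (half_subproof k) in if odd k then rev_ord h else h.

Definition stair : seq 'I_n := [seq stair_entry k | k <- enum 'I_n].

(* c_1 |-> c_2 |-> ... |-> c_k |-> c_1, other points fixed; undup makes the  *)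
(* definition total and is the identity on the sequences used below.         *)
Definition cycle_perm (c : seq 'I_n) : 'S_n :=
  perm (can_inj (prev_next (undup_uniq c))).

Definition stair_elt (a : seq nat) : 'S_n :=
  (\prod_(c <- reshape a stair) cycle_perm c)%g.

Definition stair_class (a : seq nat) : {set 'S_n} :=
  [set w | approx w (stair_elt a)].

End StairForm.

Definition center (R : nzRingType) (z : R) : Prop := forall x, GRing.comm z x.

Definition is_basis (K : fieldType) (V : lmodType K) (W : V -> Prop)
    (I : eqType) (b : I -> V) : Prop :=
  [/\ forall i, W (b i),
      forall v, W v ->
        exists (s : seq I) (c : I -> K), v = \sum_(i <- s) c i *: b i
    & forall (s : seq I) (c : I -> K), uniq s ->
        \sum_(i <- s) c i *: b i = 0 -> forall i, i \in s -> c i = 0].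

(* Main.v *)
(* Comparing the coefficients of [T_i z] and [z T_i] in the basis [T_w], the   *)
(* element [z = sum a_w T_w] is central iff [a v = a (s v) = a (v s)] whenever *)
(* [s] is simple and [l(s v s) = l(v) + 2]. Call [w] terminal if no chain of   *)
(* conjugations by simple reflections with nondecreasing lengths leads from    *)
(* [w] to a longer element. By the lifting property of the Bruhat order,       *)
(* [T_(<= Sigma)] is central for the class [Sigma] of a terminal element;      *)
(* conversely the longest elements in the support of a central element are     *)
(* terminal, and an induction on the length shows that the classes of terminal *)
(* elements index a basis of the center.                                       *)
(* It remains to see that the stair elements of maximal compositions represent *)
(* these classes. Every [w] climbs to some stair element [sigma_a], [a] a      *)
(* composition. If [a] is not maximal, it has an odd part followed by an even  *)
(* or larger part, and moving the cycle of the latter outwards increases the   *)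
(* length, so [sigma_a] is not terminal. The length of [sigma_a] for maximal   *)
(* [a] depends only on the cycle type, so such a [sigma_a] is terminal.        *)
(* Finally the cycle type, and the windows [{1..d}] exchanged with their       *)
(* mirror images [{n-d+1..n}], are invariants of [approx] that determine [a].  *)

Require Import Defs.
From mathcomp Require Import all_boot all_fingroup all_algebra.
From mathcomp Require Import generic_quotient boolp finmap monalg.
From mathcomp Require Import zify ring.

Set Implicit Arguments.
Unset Strict Implicit.
Unset Printing Implicit Defensive.

Import GRing.Theory.

(** * Length, exchange and reduced words *)

(** The [T w] are well defined by Matsumoto's theorem ([matsumoto]), span the algebra
    ([hecke_comb_exists]), and are independent because they act independently in a sorting
    representation ([hecke_comb_inj]). So a central element is a function on permutations, and
    [center_combP] says which functions occur: those with the same value at [v], [v * s i] and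
    [s i * v] whenever conjugation by [s i] lengthens [v] by 2.

    For terminal [w], the indicator of the Bruhat ideal generated by the class of [w] is such a
    function ([below_mulr], [below_mull]), and at length [len w] it is supported exactly on that
    class ([below_eq]). A central function is constant on the classes that form the longest part of
    its support ([central_fun_climb]), so subtracting multiples of these indicators lowers the
    support length. This gives [below_basis] for any system of representatives of the terminal
    classes.

    That maximal compositions give such a system is combinatorics of stair elements. [climb_stair]
    and [tau_of_injection] lead from any permutation up to a stair element; [bad_pair_not_terminal]
    excludes the non-maximal compositions; equality of lengths for equal cycle type
    ([stair_len_perm]) gives [staircase_max_terminal]; [staircase_max_inj] recovers the composition
    from invariants of the class. *)

Section Coxeter.
Local Open Scope group_scope.
Variable n : nat.
Implicit Types (u v w x : 'S_n) (i j k : 'I_n.-1) (r q : seq 'I_n.-1).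

Local Notation s := (@cox_gen n).
Local Notation len := (@cox_len n).

Definition gen_lo i : 'I_n := Ordinal (ltnW (ord_succ_subproof i)).
Definition gen_hi i : 'I_n := Ordinal (ord_succ_subproof i).

Lemma cox_genE i (a : 'I_n) :
  s i a = (if a == i :> nat then i.+1 else if a == i.+1 :> nat then i : nat else a : nat)
    :> nat.
Proof.
rewrite /cox_gen; case: tpermP => [->|->|/eqP na /eqP nb] /=.
- by rewrite eqxx.
- by rewrite eqxx eqn_leq ltnn.
- by rewrite -!val_eqE /= in na nb; rewrite (negPf na) (negPf nb).
Qed.

Lemma cox_gen_lo i : s i (gen_lo i) = gen_hi i.
Proof. exact: tpermL. Qed.

Lemma cox_gen_hi i : s i (gen_hi i) = gen_lo i.
Proof. exact: tpermR. Qed.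

Lemma cox_genK i : s i * s i = 1.
Proof. exact: tperm2. Qed.

Lemma cox_genKx i (a : 'I_n) : s i (s i a) = a.
Proof. exact: tpermK. Qed.

Lemma cox_genV i : (s i)^-1 = s i.
Proof. exact: tpermV. Qed.

Lemma cox_mulrK i w : w * s i * s i = w.
Proof. by rewrite -mulgA cox_genK mulg1. Qed.

Lemma cox_mullK i w : s i * (s i * w) = w.
Proof. by rewrite mulgA cox_genK mul1g. Qed.

Lemma cox_gen_lt i (a b : 'I_n) : (a < b)%N ->
  ~~ ((a == i :> nat) && (b == i.+1 :> nat)) -> (s i a < s i b)%N.
Proof. by rewrite !cox_genE; do !case: eqP; lia. Qed.

Lemma cox_lenV w : len w^-1 = len w.
Proof.
pose f (p : 'I_n * 'I_n) := (w p.2, w p.1).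
have f_inj : injective f by move=> [a b] [c d] [/perm_inj -> /perm_inj ->].
rewrite /cox_len -[RHS](card_imset _ f_inj); apply: eq_card => -[a b].
rewrite inE /=; apply/idP/imsetP => [/andP[ab ba]|[[c d]]].
  by exists (w^-1 b, w^-1 a); rewrite ?inE /f /= ?ab ?ba ?permKV.
by rewrite inE /= => /andP[cd dc] [-> ->]; rewrite dc !permK.
Qed.

(** Applying [s i] to both entries maps the inversions of [w] bijectively onto those of [s i * w]
    other than the pair [(gen_lo i, gen_hi i)]. *)
Lemma cox_len_mull i w : (w (gen_lo i) < w (gen_hi i))%N ->
  len (s i * w) = (len w).+1.
Proof.
move=> wi; pose f (p : 'I_n * 'I_n) := (s i p.1, s i p.2).
have f_inj : injective f by move=> [a b] [c d] [/perm_inj -> /perm_inj ->].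
rewrite /cox_len (cardsD1 (gen_lo i, gen_hi i)) inE /= !permM.
rewrite cox_gen_lo cox_gen_hi wi ltnSn add1n; congr _.+1.
rewrite -[RHS](card_imset _ f_inj); apply: eq_card => -[a b]; rewrite !inE /= !permM.
apply/idP/imsetP => [/and3P[neq ab wab]|[[c d]]].
  exists (s i a, s i b); rewrite ?inE /f /= ?cox_genKx // wab andbT.
  by apply: cox_gen_lt => //; apply: contra neq; rewrite -pair_eqE /= -!val_eqE.
rewrite inE /= => /andP[cd wcd] [-> ->]; rewrite !cox_genKx wcd andbT.
have ncd : ~~ ((c == i :> nat) && (d == i.+1 :> nat)).
  apply/negP => /andP[/eqP ci /eqP di]; have ci' : c = gen_lo i by exact: val_inj.
  have di' : d = gen_hi i by exact: val_inj.
  by move: wcd; rewrite ci' di'; lia.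
rewrite cox_gen_lt // andbT -pair_eqE /= -!val_eqE /= !cox_genE.
by apply/negP; do !case: eqP; lia.
Qed.

(** Left and right refer to composition of functions. As the library product applies its left factor
    first, a left descent concerns [w * s i] and a right descent [s i * w]. *)
Definition rdesc w i := (w (gen_hi i) < w (gen_lo i))%N.
Definition ldesc w i := rdesc w^-1 i.

Lemma rdescPn w i : ~~ rdesc w i = (w (gen_lo i) < w (gen_hi i))%N.
Proof.
have := @perm_inj _ w (gen_lo i) (gen_hi i).
rewrite /rdesc -leqNgt ltn_neqAle => wi; case: eqP => //= /ord_inj /wi /(congr1 val) /=.
by lia.
Qed.

Lemma rdesc_mull w i : rdesc (s i * w) i = ~~ rdesc w i.
Proof. by rewrite rdescPn /rdesc !permM cox_gen_lo cox_gen_hi. Qed.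

Lemma cox_len_mullE w i :
  len (s i * w) = if rdesc w i then (len w).-1 else (len w).+1.
Proof.
case: ifPn => [wi|]; last by rewrite rdescPn; exact: cox_len_mull.
by rewrite -{2}(cox_mullK i w) [in RHS]cox_len_mull // -rdescPn rdesc_mull negbK.
Qed.

Lemma ldesc_mulr w i : ldesc (w * s i) i = ~~ ldesc w i.
Proof. by rewrite /ldesc invMg cox_genV rdesc_mull. Qed.

Lemma cox_len_mulrE w i :
  len (w * s i) = if ldesc w i then (len w).-1 else (len w).+1.
Proof. by rewrite -cox_lenV invMg cox_genV cox_len_mullE cox_lenV. Qed.

Lemma rdesc_len_gt0 w i : rdesc w i -> (0 < len w)%N.
Proof.
move=> wi; have := cox_len_mullE (s i * w) i.
by rewrite rdesc_mull wi cox_mullK => ->.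
Qed.

Lemma ldesc_len_gt0 w i : ldesc w i -> (0 < len w)%N.
Proof. by move/rdesc_len_gt0; rewrite cox_lenV. Qed.

Lemma rdesc_len w i : rdesc w i = (len (s i * w) < len w)%N.
Proof.
rewrite cox_len_mullE; case: ifP => [/rdesc_len_gt0|_]; last by rewrite ltnNge leqnSn.
by case: (len w) => //= m _; rewrite ltnSn.
Qed.

Lemma ldesc_len w i : ldesc w i = (len (w * s i) < len w)%N.
Proof. by rewrite /ldesc rdesc_len -cox_lenV invMg invgK cox_genV cox_lenV. Qed.

(** Without left descents [w^-1] is strictly increasing; induction from the bottom ([v_ge]) and from
    the top ([v_le]) squeezes it onto the identity. *)
Lemma no_ldesc w : (forall i, ~~ ldesc w i) -> w = 1.
Proof.
move=> w_asc; suff vE (a : 'I_n) : w^-1 a = a.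
  by apply: invg_inj; apply/permP => a; rewrite vE invg1 perm1.
set v := w^-1 in w_asc *.
have vS (b : nat) (bn : (b.+1 < n)%N) (bn' : (b < n)%N) :
    (v (Ordinal bn') < v (Ordinal bn))%N.
  have bi : (b < n.-1)%N by lia.
  have := w_asc (Ordinal bi); rewrite /ldesc rdescPn -/v.
  rewrite (_ : gen_lo _ = Ordinal bn'); last exact: val_inj.
  by rewrite (_ : gen_hi _ = Ordinal bn) //; exact: val_inj.
have v_ge (b : nat) (bn : (b < n)%N) : (b <= v (Ordinal bn))%N.
  elim: b bn => // b IH bn; have bn' := ltnW bn.
  exact: leq_ltn_trans (IH bn') (vS b bn bn').
have v_le (c b : nat) (bn : (b < n)%N) : (b + c = n.-1)%N -> (v (Ordinal bn) <= b)%N.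
  elim: c b bn => [|c IH] b bn bc; first by have := ltn_ord (v (Ordinal bn)); lia.
  have bn1 : (b.+1 < n)%N by lia.
  by have := leq_trans (vS b bn1 bn) (IH b.+1 bn1 ltac:(lia)).
case: a => b bn; apply: val_inj => /=; apply/eqP.
by rewrite eqn_leq v_ge (v_le (n.-1 - b)%N) //; lia.
Qed.

Lemma word_perm_cons i r : word_perm (i :: r) = word_perm r * s i.
Proof. by []. Qed.

Lemma word_perm_cat r q : word_perm (r ++ q) = word_perm q * word_perm r.
Proof.
elim: r => [|i r IH]; first by rewrite /word_perm /= mulg1.
by rewrite cat_cons word_perm_cons IH -mulgA -word_perm_cons.
Qed.

Lemma word_perm1 i : word_perm [:: i] = s i.
Proof. by rewrite word_perm_cons /word_perm /= mul1g. Qed.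

Lemma cox_len1 : len 1 = 0%N.
Proof. by apply/eqP; rewrite cards_eq0 -subset0; apply/subsetP => -[a b];
  rewrite inE !perm1 /=; lia. Qed.

Lemma cox_len_word r : (len (word_perm r) <= size r)%N.
Proof.
elim: r => [|i r IH]; first by rewrite cox_len1.
by rewrite word_perm_cons cox_len_mulrE /=; case: ifP; lia.
Qed.

Lemma reduced_exists w : exists r, reduced_word w r.
Proof.
have [m] := ubnP (len w); elim: m w => // m IH w wm.
case: (pickP (ldesc w)) => [i wi|w0].
  have lwi : len w = (len (w * s i)).+1.
    by rewrite cox_len_mulrE wi prednK // (ldesc_len_gt0 wi).
  have [|r /andP[/eqP rw /eqP rl]] := IH (w * s i); first by rewrite -ltnS -lwi.
  exists (i :: r); rewrite /reduced_word word_perm_cons rw cox_mulrK eqxx /=.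
  by rewrite rl lwi.
exists [::]; have -> : w = 1 by apply: no_ldesc => i; rewrite w0.
by rewrite /reduced_word cox_len1 !eqxx.
Qed.

Lemma reduced_cons w i r :
  reduced_word w (i :: r) = ldesc w i && reduced_word (w * s i) r.
Proof.
rewrite /reduced_word word_perm_cons cox_len_mulrE /=.
have -> : (word_perm r * s i == w) = (word_perm r == w * s i).
  by apply/eqP/eqP => [<-|->]; rewrite cox_mulrK.
case: eqP => [rw|_] /=; last by rewrite andbF.
have := cox_len_word r; rewrite rw cox_len_mulrE.
case: ifP => [/ldesc_len_gt0|_] /=; last by lia.
by case: (len w) => //= m _ _; rewrite eqSS.
Qed.

Lemma reduced_rcons w i r :
  reduced_word w (rcons r i) = rdesc w i && reduced_word (s i * w) r.
Proof.
rewrite /reduced_word -cats1 word_perm_cat word_perm1 size_cat addn1.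
have -> : (s i * word_perm r == w) = (word_perm r == s i * w).
  by apply/eqP/eqP => [<-|->]; rewrite cox_mullK.
case: eqP => [rw|_] /=; last by rewrite andbF.
have := cox_len_word r; rewrite rw cox_len_mullE.
case: ifP => [/rdesc_len_gt0|_] /=; last by lia.
by case: (len w) => //= m _ _; rewrite eqSS.
Qed.

(** The word need not be reduced. Push the pair [a < b] through its letters: a letter keeps the
    order of the pair unless it is the transposition of the pair, and some letter is, since the pair
    ends up inverted. Deleting that letter amounts to multiplying by [tperm a b]. *)
Lemma strong_exchange q (a b : 'I_n) : (a < b)%N ->
    ((word_perm q)^-1 b < (word_perm q)^-1 a)%N ->
  exists2 q', subseq q' q & size q' = (size q).-1 /\ word_perm q' = word_perm q * tperm a b.
Proof.
elim: q a b => [|j q IH] a b ab; first by rewrite /word_perm /= invg1 !perm1; lia.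
rewrite word_perm_cons invMg cox_genV !permM => qab.
have [/andP[/eqP aj /eqP bj]|nab] := boolP ((a == j :> nat) && (b == j.+1 :> nat)).
  have -> : tperm a b = s j by congr tperm; apply: val_inj.
  by exists q; rewrite ?subseq_cons // cox_mulrK.
have [q' sub [sz q'E]] := IH _ _ (cox_gen_lt ab nab) qab.
exists (j :: q'); first by rewrite /= eqxx.
split.
  rewrite /= sz; case: (q) qab => //; rewrite /word_perm /= invg1 !perm1.
  by rewrite ltnNge ltnW ?cox_gen_lt.
rewrite word_perm_cons q'E -!mulgA; congr (_ * _).
by rewrite -tpermJ /conjg cox_genV -!mulgA cox_genK mulg1.
Qed.

Lemma exchange w q i : reduced_word w q -> ldesc w i ->
  exists2 q', subseq q' q & reduced_word (w * s i) q'.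
Proof.
move=> /andP[/eqP qw /eqP ql] wi.
have [||q' sub [sz q'E]] := @strong_exchange q (gen_lo i) (gen_hi i).
- by rewrite /=.
- by rewrite qw.
exists q' => //; rewrite /reduced_word q'E qw eqxx sz ql.
by rewrite cox_len_mulrE wi eqxx.
Qed.

Lemma reduced_subword q : exists2 q', subseq q' q & reduced_word (word_perm q) q'.
Proof.
elim: q => [|i q [q' sub red]]; first by exists [::];
  rewrite // /reduced_word cox_len1 !eqxx.
rewrite word_perm_cons.
have [di|ndi] := boolP (ldesc (word_perm q) i).
  have [q2 sub2 red2] := exchange red di.
  by exists q2 => //; apply: subseq_trans (subseq_cons _ i); apply: subseq_trans sub.
exists (i :: q'); first by rewrite /= eqxx.
by rewrite reduced_cons ldesc_mulr ndi cox_mulrK.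
Qed.

Lemma cox_gen_fix i (a : 'I_n) : (a != i :> nat) -> (a != i.+1 :> nat) -> s i a = a.
Proof. by move=> ai aSi; apply: val_inj;
  rewrite /= cox_genE (negPf ai) (negPf aSi). Qed.

Lemma gen_hi_lo i j : j = i.+1 :> nat -> gen_hi i = gen_lo j.
Proof. by move=> ji; apply: val_inj. Qed.

Lemma ldesc_comm w i j : (i.+1 < j)%N || (j.+1 < i)%N ->
  ldesc (w * s i) j = ldesc w j.
Proof.
move=> ij; rewrite /ldesc invMg cox_genV /rdesc !permM !cox_gen_fix //=; lia.
Qed.

Section Adjacent.
Variables (w : 'S_n) (i j : 'I_n.-1).
Hypothesis ij : j = i.+1 :> nat.

(** Whether the outer two of three consecutive values are inverted; after applying one of [s i],
    [s j], this decides the descent at the other. *)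
Definition inverts3 := (w^-1 (gen_hi j) < w^-1 (gen_lo i))%N.

Lemma ldesc_adj_lo : ldesc (w * s i) j = inverts3.
Proof.
rewrite /ldesc invMg cox_genV /rdesc !permM -(gen_hi_lo ij) cox_gen_hi.
by rewrite cox_gen_fix //=; lia.
Qed.

Lemma ldesc_adj_hi : ldesc (w * s j) i = inverts3.
Proof.
rewrite /ldesc invMg cox_genV /rdesc !permM (gen_hi_lo ij) cox_gen_lo.
by rewrite cox_gen_fix //=; lia.
Qed.

Lemma ldesc_adj_lohi : ldesc (w * s i * s j) i = ldesc w j.
Proof.
rewrite /ldesc !invMg !cox_genV /rdesc !permM (gen_hi_lo ij) cox_gen_lo.
rewrite [s i (gen_hi j)]cox_gen_fix /=; try lia.
rewrite [s j (gen_lo i)]cox_gen_fix /=; try lia.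
by rewrite cox_gen_lo (gen_hi_lo ij).
Qed.

Lemma ldesc_adj_hilo : ldesc (w * s j * s i) j = ldesc w i.
Proof.
rewrite /ldesc !invMg !cox_genV /rdesc !permM -(gen_hi_lo ij) cox_gen_hi.
rewrite [s i (gen_hi j)]cox_gen_fix /=; try lia.
rewrite [s j (gen_lo i)]cox_gen_fix /=; try lia.
by rewrite cox_gen_hi (gen_hi_lo ij).
Qed.

Lemma inverts3T : ldesc w i -> ldesc w j -> inverts3.
Proof. by rewrite /ldesc /rdesc (gen_hi_lo ij) => di dj; apply: ltn_trans di. Qed.

Lemma inverts3F : ~~ ldesc w i -> ~~ ldesc w j -> ~~ inverts3.
Proof.
by rewrite /ldesc /rdesc (gen_hi_lo ij) -!leqNgt => di dj; apply: leq_trans dj.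
Qed.

End Adjacent.

Lemma ldesc_braid w i j : (j == i.+1 :> nat) || (i == j.+1 :> nat) ->
  ldesc w i -> ldesc w j -> ldesc (w * s i) j && ldesc (w * s i * s j) i.
Proof.
case/orP=> /eqP ij wi wj.
  by rewrite ldesc_adj_lo // ldesc_adj_lohi // inverts3T.
by rewrite ldesc_adj_hi // ldesc_adj_hilo // inverts3T.
Qed.

Lemma cox_gen_comm i j : (i.+1 < j)%N || (j.+1 < i)%N -> s i * s j = s j * s i.
Proof.
move=> ij; apply/permP => a; apply: val_inj; rewrite /= !permM.
by rewrite !cox_genE; do !case: eqP; lia.
Qed.

Lemma cox_gen_braid i j : j = i.+1 :> nat -> s i * s j * s i = s j * s i * s j.
Proof.
move=> ij; apply/permP => a; apply: val_inj; rewrite /= !permM.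
by rewrite !cox_genE; do !case: eqP; lia.
Qed.

(** Stated for an arbitrary equivalence [R] so that it serves both the Bruhat order and the products
    of generators. If two reduced words begin with distinct letters [i] and [j], both are descents
    of [w], so [w] also has reduced words with a common tail [t] that begin with the two sides of
    the relation between [i] and [j]; induction links each given word to the one sharing its first
    letter. *)
Lemma matsumoto (R : seq 'I_n.-1 -> seq 'I_n.-1 -> Prop) :
    (forall r, R r r) -> (forall r q, R r q -> R q r) ->
    (forall r q t, R r q -> R q t -> R r t) ->
    (forall i r q, R r q -> R (i :: r) (i :: q)) ->
    (forall i j r, (i.+1 < j)%N || (j.+1 < i)%N ->
       R [:: i, j & r] [:: j, i & r]) ->
    (forall i j r, j = i.+1 :> nat ->
       R [:: i, j, i & r] [:: j, i, j & r]) ->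
  forall w r q, reduced_word w r -> reduced_word w q -> R r q.
Proof.
move=> Rr Rs Rt Rc Rcomm Rbraid w r q.
have [m] := ubnP (len w); elim: m w r q => // m IH w [|i r] [|j q] wm rr rq //.
- by move: rr rq; rewrite /reduced_word /= => /andP[_ /eqP <-] /andP[].
- by move: rr rq; rewrite /reduced_word /= => /andP[_ /eqP <-] /andP[].
have lenr : len w = (size r).+1 by move: rr => /andP[_ /eqP].
have lenq : len w = (size q).+1 by move: rq => /andP[_ /eqP].
move: (rr) (rq); rewrite !reduced_cons => /andP[wi rr'] /andP[wj rq'].
have lr : len (w * s i) = size r by case/andP: rr' => _ /eqP.
have lq : len (w * s j) = size q by case/andP: rq' => _ /eqP.
have IHi r1 r2 : reduced_word (w * s i) r1 -> reduced_word (w * s i) r2 -> R r1 r2.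
  by apply: IH; lia.
have IHj r1 r2 : reduced_word (w * s j) r1 -> reduced_word (w * s j) r2 -> R r1 r2.
  by apply: IH; lia.
have [eij|nij] := eqVneq i j; first by rewrite eij in IHi rr' *; apply: Rc; apply: IHi.
have [far|near] := boolP ((i.+1 < j)%N || (j.+1 < i)%N).
  have [t rt] := reduced_exists (w * s i * s j).
  have rjt : reduced_word (w * s i) (j :: t) by rewrite reduced_cons ldesc_comm ?wj.
  have rit : reduced_word (w * s j) (i :: t).
    by rewrite reduced_cons ldesc_comm 1?orbC ?wi //= -mulgA (cox_gen_comm (i:=j)) 1?orbC // mulgA.
  apply: (Rt) (Rc i _ _ (IHi _ _ rr' rjt)) _.
  by apply: (Rt) (Rcomm _ _ _ far) _; apply: Rc; apply: IHj.
have adj : (j == i.+1 :> nat) || (i == j.+1 :> nat) by move: nij;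
  rewrite -val_eqE /=; lia.
have adj' : (i == j.+1 :> nat) || (j == i.+1 :> nat) by rewrite orbC.
have bij : s i * s j * s i = s j * s i * s j.
  by case/orP: adj => /eqP /cox_gen_braid ->.
have [t rt] := reduced_exists (w * s i * s j * s i).
have /andP[d1 d2] := ldesc_braid adj wi wj.
have /andP[d3 d4] := ldesc_braid adj' wj wi.
have rjt : reduced_word (w * s i) [:: j, i & t] by rewrite !reduced_cons d1 d2.
have rit : reduced_word (w * s j) [:: i, j & t].
  rewrite !reduced_cons d3 d4 /=; move: rt; congr reduced_word.
  by rewrite -!mulgA; congr (_ * _); rewrite !mulgA bij.
apply: (Rt) (Rc i _ _ (IHi _ _ rr' rjt)) _.
apply: (Rt) (Rc j _ _ (IHj _ _ rit rq')).
by case/orP: adj => /eqP eij; [apply: Rbraid | apply: Rs; apply: Rbraid].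
Qed.

(** The descent compares the positions of two adjacent values. Swapping the positions [i] and [i.+1]
    changes this comparison only if they are the two positions in question, and then [s i] commutes
    with [w]. *)
Lemma ldesc_mull w i : s i * w * s i != w -> ldesc (s i * w) i = ldesc w i.
Proof.
move=> neq; rewrite /ldesc invMg cox_genV /rdesc !permM.
set a := w^-1 _; set b := w^-1 _.
have ab : a != b by rewrite (inj_eq perm_inj) -val_eqE /=; lia.
have nab : ~~ [&& (a == i :> nat) || (a == i.+1 :> nat) & (b == i :> nat) || (b == i.+1 :> nat)].
  apply: contra neq => abi; apply/eqP/permP => c; rewrite !permM.
  have wa : w a = gen_hi i by rewrite permKV.
  have wb : w b = gen_lo i by rewrite permKV.
  have [ca|ca] := eqVneq c a; last have [cb|cb] := eqVneq c b.
  - rewrite ca (_ : s i a = b) ?wb ?cox_gen_lo //.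
    apply: val_inj; move: abi ab; rewrite /= cox_genE -val_eqE /=.
    by do !case: eqP; lia.
  - rewrite cb (_ : s i b = a) ?wa ?cox_gen_hi //.
    apply: val_inj; move: abi ab; rewrite /= cox_genE -val_eqE /=.
    by do !case: eqP; lia.
  have [ci ci'] : (c != i :> nat) /\ (c != i.+1 :> nat).
    by move: abi ab ca cb; rewrite -!val_eqE /=; lia.
  rewrite (cox_gen_fix ci ci') cox_gen_fix //; apply/negP => /eqP e.
    by case/eqP: cb; apply: (@perm_inj _ w); rewrite wb; apply: val_inj.
  by case/eqP: ca; apply: (@perm_inj _ w); rewrite wa; apply: val_inj.
move: nab ab; rewrite -val_eqE /= !cox_genE; do !case: eqP => //=; lia.
Qed.

Lemma conj_mulr_neq w i : (s i * (w * s i) * s i != w * s i) = (s i * w * s i != w).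
Proof. by rewrite mulgA (inj_eq (mulIg _)). Qed.

Lemma conj_mull_neq w i : (s i * (s i * w) * s i != s i * w) = (s i * w * s i != w).
Proof. by rewrite -[s i * (s i * w) * s i]mulgA (inj_eq (mulgI _)). Qed.

Lemma conj_conj_neq w i :
  (s i * (s i * w * s i) * s i != s i * w * s i) = (s i * w * s i != w).
Proof. by rewrite -[RHS]conj_mulr_neq -[RHS]conj_mull_neq !mulgA. Qed.

Lemma conjV_neq w i : (s i * w^-1 * s i != w^-1) = (s i * w * s i != w).
Proof. by rewrite -{1 2}(cox_genV i) -!invMg (inj_eq invg_inj) mulgA. Qed.

Lemma rdesc_mulr w i : s i * w * s i != w -> rdesc (w * s i) i = rdesc w i.
Proof.
by rewrite -conjV_neq => /ldesc_mull; rewrite /ldesc invMg cox_genV !invgK.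
Qed.

Lemma conj_eq_desc w i : s i * w * s i = w -> ldesc w i = rdesc w i.
Proof.
move=> e; rewrite rdesc_len ldesc_len; congr (len _ < _)%N.
by rewrite -{1}e cox_mulrK.
Qed.

Lemma cox_len_conj w i : s i * w * s i != w ->
  len (s i * w * s i) =
    if ldesc w i then (if rdesc w i then (len w).-2 else len w)
    else (if rdesc w i then len w else (len w).+2).
Proof.
move=> neq; rewrite cox_len_mulrE ldesc_mull // cox_len_mullE.
have rd0 : rdesc w i -> (0 < len w)%N by exact: rdesc_len_gt0.
move: rd0; case: (ldesc w i); case: (rdesc w i) => //= /(_ isT); by case: (len w).
Qed.

End Coxeter.

(** * Bruhat order *)

Section Bruhat.
Local Open Scope group_scope.
Variable n : nat.
Implicit Types (u v w x : 'S_n) (i j k : 'I_n.-1) (r q : seq 'I_n.-1).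

Local Notation s := (@cox_gen n).
Local Notation len := (@cox_len n).

(** Arbitrary subwords of a fixed word, reduced or not: the first letter is skipped or used. *)
Fixpoint subword r u : bool :=
  if r is i :: r' then subword r' u || subword r' (u * s i) else u == 1.

Lemma subwordP r u :
  reflect (exists2 q, subseq q r & word_perm q = u) (subword r u).
Proof.
elim: r u => [|i r IH] u /=.
  apply: (iffP eqP) => [->|[q]]; first by exists [::].
  by case: q => // _ <-.
apply: (iffP orP) => [[/IH[q sub <-]|/IH[q sub qu]]|[[|j q] sub <-]].
- by exists q => //; apply: subseq_trans (subseq_cons _ _).
- exists (i :: q); first by rewrite /= eqxx.
  by rewrite word_perm_cons qu cox_mulrK.
- by left; apply/IH; exists [::]; rewrite ?sub0seq.
- move: sub; rewrite [subseq _ _]/=; case: eqP => [-> sub|_ sub].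
    by right; apply/IH; exists q => //; rewrite word_perm_cons cox_mulrK.
  by left; apply/IH; exists (j :: q).
Qed.

Lemma subword_reduced w r q u :
  reduced_word w r -> reduced_word w q -> subword r u = subword q u.
Proof.
move=> rr rq.
pose R r q := forall u, subword r u = subword q u.
suff: R r q by apply.
apply: (@matsumoto _ R _ _ _ _ _ _ w) => //.
- by move=> ? ? H v; rewrite H.
- by move=> ? ? ? + + v => -> ->.
- by move=> i r1 r2 E v; rewrite /= !E.
- move=> i j t ij v /=; rewrite -!mulgA (cox_gen_comm ij) -!orbA; congr (_ || _).
  by rewrite orbCA.
move=> i j t /cox_gen_braid E v /=; rewrite -!mulgA !(mulgA (s i)) !(mulgA (s j)) E.
rewrite !cox_genK ?mul1g !mulg1.
by do 6!case: (subword t _) => //=.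
Qed.

(** By [matsumoto] the set of products of subwords is the same for all reduced words of [w], and a
    subword can be thinned to a reduced one by [reduced_subword]. *)
Lemma bruhatE w r u : reduced_word w r -> bruhat u w = subword r u.
Proof.
move=> rr; apply/existsP/subwordP => [[t /existsP[q /and3P[rt rq sub]]]|].
  apply/subwordP; rewrite (subword_reduced u rr rt); apply/subwordP.
  by exists q => //; case/andP: rq => /eqP.
case=> q sub qu; have [q' sub' rq'] := reduced_subword q; rewrite qu in rq'.
have /andP[_ rs] := rr; have /andP[_ qs] := rq'.
exists (Tuple rs); apply/existsP; exists (Tuple qs).
by rewrite /= rr rq' (subseq_trans sub').
Qed.

Lemma bruhat_refl w : bruhat w w.
Proof.
have [r rr] := reduced_exists w; rewrite (bruhatE _ rr).
by apply/subwordP; exists r => //; case/andP: rr => /eqP.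
Qed.

Lemma bruhat_sub u w : bruhat u w ->
  exists r q, [/\ reduced_word w r, reduced_word u q & subseq q r].
Proof. by move=> /existsP[r /existsP[q /and3P[]]]; exists r, q. Qed.

Lemma bruhat_len u w : bruhat u w -> (len u <= len w)%N.
Proof.
case/bruhat_sub => r [q [/andP[_ /eqP <-] /andP[_ /eqP <-]]].
exact: size_subseq.
Qed.

Lemma bruhat_len_eq u w : bruhat u w -> len u = len w -> u = w.
Proof.
case/bruhat_sub => r [q [/andP[/eqP <- /eqP lr] /andP[/eqP <- /eqP lq]]] sub e.
have /eqP -> // : q == r by rewrite -(size_subseq_leqif sub) lr lq e.
Qed.

Lemma word_perm_rev r : word_perm (rev r) = (word_perm r)^-1.
Proof.
elim: r => [|i r IH]; first by rewrite /word_perm /= invg1.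
by rewrite rev_cons -cats1 word_perm_cat word_perm1 IH word_perm_cons invMg cox_genV.
Qed.

Lemma reduced_rev w r : reduced_word w^-1 (rev r) = reduced_word w r.
Proof. by rewrite /reduced_word word_perm_rev size_rev cox_lenV (inj_eq invg_inj). Qed.

Lemma bruhatV u w : bruhat u w -> bruhat u^-1 w^-1.
Proof.
case/bruhat_sub => r [q [rr rq sub]].
rewrite (@bruhatE _ (rev r)) ?reduced_rev //; apply/subwordP.
exists (rev q); first by rewrite subseq_rev.
by rewrite word_perm_rev; case/andP: rq => /eqP ->.
Qed.

Lemma ldescV w i : ldesc w^-1 i = rdesc w i.
Proof. by rewrite /ldesc invgK. Qed.

Lemma bruhat_ldesc u w i : ldesc w i -> bruhat u w -> bruhat (u * s i) w.
Proof.
move=> wi; have [r rr] := reduced_exists (w * s i).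
have rir : reduced_word w (i :: r) by rewrite reduced_cons wi.
by rewrite !(bruhatE _ rir) /= cox_mulrK orbC.
Qed.

Lemma bruhat_trunc u w i : ldesc u i -> bruhat u w -> bruhat (u * s i) w.
Proof.
move=> ui /bruhat_sub[r [q [rr rq sub]]].
have [q' sub' /andP[/eqP q'E _]] := exchange rq ui.
rewrite (bruhatE _ rr); apply/subwordP; exists q' => //.
exact: subseq_trans sub.
Qed.

(** Take a reduced word of [w] beginning with [i]. A subword for [u] either avoids this letter, or
    shows that [u * s i] lies below [w * s i]; truncating then gives [u]. *)
Lemma bruhat_lower u w i : ldesc w i -> ~~ ldesc u i -> bruhat u w ->
  bruhat u (w * s i).
Proof.
move=> wi ui; have [r rr] := reduced_exists (w * s i).
have rir : reduced_word w (i :: r) by rewrite reduced_cons wi.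
rewrite (bruhatE _ rir) /= -!(bruhatE _ rr) => /orP[//|].
by move/(@bruhat_trunc _ _ i); rewrite ldesc_mulr ui cox_mulrK; apply.
Qed.

Lemma bruhat_rlower u w i : rdesc w i -> ~~ rdesc u i -> bruhat u w ->
  bruhat u (s i * w).
Proof.
rewrite -!ldescV => wi ui /bruhatV /(bruhat_lower wi ui) /bruhatV.
by rewrite invMg !invgK cox_genV.
Qed.

End Bruhat.

(** * The basis and the center of the 0-Hecke algebra *)

Section Hecke.
Local Open Scope ring_scope.
Local Open Scope quotient_scope.

Lemma mulr_congr2 (R : pzRingType) (a b c d x : R) :
  a * b = c * d -> a * (b * x) = c * (d * x).
Proof. by rewrite !mulrA => ->. Qed.

Lemma mulr_congr3 (R : pzRingType) (a b c d e f x : R) :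
  a * b * c = d * e * f -> a * (b * (c * x)) = d * (e * (f * x)).
Proof. by rewrite !mulrA => ->. Qed.

Variables (K : fieldType) (n : nat).
Implicit Types (w u v : 'S_n) (i j : 'I_n.-1) (r q : seq 'I_n.-1).
Local Notation F := (free_alg K n).
Local Notation H := (hecke0 K n).
Local Notation T := (hecke_T K).
Local Notation g := (hecke_gen K).
Local Notation s := (@cox_gen n).

Lemma hecke_piM (x y : F) : \pi_H (x * y) = \pi_H x * \pi_H y.
Proof. exact/esym/hecke_pi_mul. Qed.

Lemma hecke_piZ k (x : F) : \pi_H (k *: x) = k *: \pi_H x.
Proof. exact/esym/hecke_pi_scale. Qed.

Lemma hecke_pi0 : \pi_H 0 = 0.
Proof. by rewrite piE. Qed.

Lemma hecke_pi_sum (I : Type) (t : seq I) (P : pred I) (f : I -> F) :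
  \pi_H (\sum_(k <- t | P k) f k) = \sum_(k <- t | P k) \pi_H (f k).
Proof. by apply: (big_morph _ (@hecke_piD K n) hecke_pi0). Qed.

Lemma hecke_pi_relator (x y : F) : hecke_relator (x - y) -> \pi_H x = \pi_H y.
Proof. by move=> rel; apply/hecke_pi_eq => I _; apply. Qed.

Lemma hecke_gen_quad i : g i * g i = - g i.
Proof.
apply/eqP; rewrite -addr_eq0 -hecke_piM -hecke_piD; apply/eqP.
rewrite -hecke_pi0; apply: hecke_pi_relator; rewrite subr0; exact: HeckeQuad.
Qed.

Lemma hecke_genE i : g i = \pi_H (fgen K i).
Proof. by []. Qed.

Lemma hecke_gen_comm i j : (i.+1 < j)%N || (j.+1 < i)%N ->
  g i * g j = g j * g i.
Proof.
by move=> ij; rewrite -!hecke_piM; apply: hecke_pi_relator; apply: HeckeComm.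
Qed.

Lemma hecke_gen_braid i j : j = i.+1 :> nat ->
  g i * g j * g i = g j * g i * g j.
Proof.
move=> /(HeckeBraid K) /hecke_pi_relator E.
have piM3 (x y z : F) : \pi_H (x * y * z) = \pi_H x * \pi_H y * \pi_H z.
  exact: etrans (hecke_piM (x * y) z) (congr1 (fun t => t * _) (hecke_piM x y)).
rewrite (hecke_genE i) (hecke_genE j).
exact: etrans (esym (piM3 _ _ _)) (etrans E (piM3 _ _ _)).
Qed.

Definition hecke_word r : H := \prod_(i <- r) g i.

Lemma hecke_word_cons i r : hecke_word (i :: r) = g i * hecke_word r.
Proof. exact: big_cons. Qed.

Lemma hecke_TE w r : reduced_word w r -> T w = hecke_word r.
Proof.
move=> rr; rewrite /hecke_T; case: pickP => [q rq|]; last first.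
  by case/andP: (rr) => _ rs => /(_ (Tuple rs)); rewrite /= rr.
apply: (@matsumoto _ (fun r q => hecke_word r = hecke_word q) _ _ _ _ _ _ w) => //.
- by move=> ? ? ? -> ->.
- by move=> i t1 t2 E; rewrite !hecke_word_cons E.
- move=> i j t /hecke_gen_comm E; rewrite !hecke_word_cons.
  exact: (mulr_congr2 _ E).
- move=> i j t /hecke_gen_braid E; rewrite !hecke_word_cons.
  exact: (mulr_congr3 _ E).
Qed.

Lemma hecke_T1 : T 1%g = 1 :> H.
Proof.
rewrite (@hecke_TE _ [::]) /hecke_word ?big_nil //.
by rewrite /reduced_word cox_len1 !eqxx.
Qed.

Lemma hecke_mul_gen_T i w :
  g i * T w = if ldesc w i then - T w else T (w * s i)%g.
Proof.
case: ifPn => wi.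
  have [r rr] := reduced_exists (w * s i)%g.
  have rir : reduced_word w (i :: r) by rewrite reduced_cons wi.
  by rewrite (hecke_TE rir) hecke_word_cons mulrA hecke_gen_quad mulNr.
have [r rr] := reduced_exists w.
have rir : reduced_word (w * s i)%g (i :: r).
  by rewrite reduced_cons ldesc_mulr wi cox_mulrK.
by rewrite (hecke_TE rir) (hecke_TE rr) hecke_word_cons.
Qed.

Lemma hecke_word_rcons r i : hecke_word (rcons r i) = hecke_word r * g i.
Proof. by rewrite /hecke_word -cats1 big_cat big_seq1. Qed.

Lemma hecke_mul_T_gen i w :
  T w * g i = if rdesc w i then - T w else T (s i * w)%g.
Proof.
case: ifPn => wi.
  have [r rr] := reduced_exists (s i * w)%g.
  have rir : reduced_word w (rcons r i) by rewrite reduced_rcons wi.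
  by rewrite (hecke_TE rir) hecke_word_rcons -mulrA hecke_gen_quad mulrN.
have [r rr] := reduced_exists w.
have rir : reduced_word (s i * w)%g (rcons r i).
  by rewrite reduced_rcons rdesc_mull wi cox_mullK.
by rewrite (hecke_TE rir) (hecke_TE rr) hecke_word_rcons.
Qed.

Definition hecke_comb (a : 'S_n -> K) : H := \sum_w a w *: T w.

Definition free_word r : F := mkmalgU (FMonom r) 1.

Lemma free_word_cons i r : free_word (i :: r) = fgen K i * free_word r.
Proof.
rewrite /fgen /free_word malgM_def fgmulUU mulr1; congr mkmalgU.
by apply: val_inj; rewrite /= fmM fmuE.
Qed.

Lemma free_word_nil : free_word [::] = 1.
Proof. by congr mkmalgU; apply: val_inj; rewrite /= fm1. Qed.

Lemma pi_free_word r : \pi_H (free_word r) = hecke_word r.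
Proof.
elim: r => [|i r IH]; first by rewrite free_word_nil /hecke_word big_nil.
by rewrite free_word_cons hecke_piM IH hecke_word_cons.
Qed.

Lemma free_wordE (x : F) : x = \sum_(m <- msupp x) mcoeff m x *: free_word m.
Proof.
rewrite [LHS]monalgE; apply: eq_bigr => m _.
apply/malgP => k; rewrite mcoeffZ !mcoeffU mulrnAr mulr1; congr (_ *+ (_ == _)).
Qed.

(** Left multiplication by a generator sends each [T w] to some [T v] up to sign, so the span of the
    [T w] contains all monomials. *)
Lemma hecke_comb_exists (x : H) : exists a, x = hecke_comb a.
Proof.
have comb0 : exists a, 0 = hecke_comb a.
  by exists (fun=> 0); rewrite /hecke_comb big1 // => w _; rewrite scale0r.
have combD y z : (exists a, y = hecke_comb a) -> (exists a, z = hecke_comb a) ->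
    exists a, y + z = hecke_comb a.
  move=> [a ->] [b ->]; exists (fun w => a w + b w).
  by rewrite /hecke_comb -big_split; apply: eq_bigr => w _; rewrite scalerDl.
have combZ k y : (exists a, y = hecke_comb a) -> exists a, k *: y = hecke_comb a.
  move=> [a ->]; exists (fun w => k * a w).
  by rewrite /hecke_comb scaler_sumr; apply: eq_bigr => w _; rewrite scalerA.
have combT w : exists a, T w = hecke_comb a.
  exists (fun v => (v == w)%:R); rewrite /hecke_comb (bigD1 w) //= eqxx scale1r.
  by rewrite big1 ?addr0 // => v /negPf ->; rewrite scale0r.
have comb_sum (I : Type) (t : seq I) (f : I -> H) :
    (forall k, exists a, f k = hecke_comb a) -> exists a, \sum_(k <- t) f k = hecke_comb a.
  by move=> fP; apply: (big_ind (fun y => exists a, y = hecke_comb a)).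
have comb_word r : exists a, hecke_word r = hecke_comb a.
  elim: r => [|i r [a ra]]; first by rewrite /hecke_word big_nil -hecke_T1.
  rewrite hecke_word_cons ra /hecke_comb mulr_sumr; apply: comb_sum => w.
  rewrite -scalerAr; apply: (combZ); rewrite hecke_mul_gen_T; case: ifP => // _.
  by rewrite -scaleN1r; apply: (combZ).
rewrite -[x]reprK (free_wordE (repr x)) hecke_pi_sum; apply: comb_sum => m.
by rewrite hecke_piZ pi_free_word; apply: combZ.
Qed.

(* [- T_i] acts on permutations as the sorting operator [w |-> max w (s_i w)]; *)
(* this gives a representation of the algebra in which the [T w] are          *)
(* independent. *)
Definition sort_step i u : 'S_n := if ldesc u i then u else (u * s i)%g.

Lemma sort_step_idem i u : sort_step i (sort_step i u) = sort_step i u.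
Proof.
rewrite [sort_step i u]/sort_step; case: ifPn => ui; rewrite /sort_step ?ui //.
by rewrite ldesc_mulr ui.
Qed.

Lemma sort_step_comm i j u : (i.+1 < j)%N || (j.+1 < i)%N ->
  sort_step i (sort_step j u) = sort_step j (sort_step i u).
Proof.
move=> ij; have ji : (j.+1 < i)%N || (i.+1 < j)%N by rewrite orbC.
rewrite /sort_step; case: (boolP (ldesc u i)) (boolP (ldesc u j)) => [di|di] [dj|dj];
  rewrite ?ldesc_comm // ?(negPf di) ?(negPf dj) ?di ?dj //.
by rewrite -!mulgA (cox_gen_comm ij).
Qed.

Lemma sort_step_braid i j u : j = i.+1 :> nat ->
  sort_step i (sort_step j (sort_step i u)) =
  sort_step j (sort_step i (sort_step j u)).
Proof.
move=> ij; have E := cox_gen_braid ij.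
have := inverts3T ij (w := u); have := inverts3F ij (w := u).
rewrite /sort_step.
have [di|di] := boolP (ldesc u i); have [dj|dj] := boolP (ldesc u j) => /=.
- by rewrite di dj.
- rewrite !ldesc_adj_hi // => _ _; case: (inverts3 u i j); rewrite ?ldesc_mulr ?dj //.
  by rewrite ldesc_adj_hilo // di.
- rewrite (negPf di) !ldesc_adj_lo // => _ _; case: (inverts3 u i j);
  rewrite ?ldesc_mulr ?di //.
  by rewrite ldesc_adj_lohi // dj.
move=> /(_ isT isT) /negPf d3 _.
rewrite [ldesc (u * s i) j]ldesc_adj_lo // [ldesc (u * s j) i]ldesc_adj_hi // d3.
rewrite ldesc_adj_lohi // ldesc_adj_hilo //.
by rewrite (negPf dj) (negPf di) -!mulgA !(mulgA (s _)) E.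
Qed.

Definition sort_word r u : 'S_n := foldr sort_step u r.

Lemma sort_word_reduced w r : reduced_word w r -> sort_word r 1%g = w.
Proof.
elim: r w => [|i r IH] w; first by case/andP => /eqP.
rewrite reduced_cons => /andP[wi /IH] /= ->.
by rewrite /sort_step ldesc_mulr wi cox_mulrK.
Qed.

(** [sort_coef u w x] is the coefficient of [w] in the image of [u] under [x], in the representation
    where each generator acts as minus [sort_step]. *)
Definition sort_sign u w (m : {fmonom 'I_n.-1}) : K :=
  (-1) ^+ size m * (sort_word m u == w)%:R.
Definition sort_coef u w (x : {malg K[{fmonom 'I_n.-1}]}) : K :=
  mmap idfun (sort_sign u w) x.

Lemma sort_coef_word u w r :
  sort_coef u w (free_word r) = (-1) ^+ size r * (sort_word r u == w)%:R.
Proof. by rewrite /sort_coef mmapU mul1r. Qed.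

Lemma sort_coefD u w (x y : F) :
  sort_coef u w (x + y) = sort_coef u w x + sort_coef u w y.
Proof. exact: raddfD. Qed.

Lemma sort_coefB u w (x y : F) :
  sort_coef u w (x - y) = sort_coef u w x - sort_coef u w y.
Proof. exact: raddfB. Qed.

Lemma sort_coefM u w (x y : F) :
  sort_coef u w (x * y) = \sum_v sort_coef u v y * sort_coef v w x.
Proof.
rewrite /sort_coef malgME raddf_sum /=.
transitivity (\sum_(k1 <- msupp x) \sum_v
   mmap idfun (sort_sign u v) y * (mcoeff k1 x * sort_sign v w k1)); last first.
  by rewrite exchange_big; apply: eq_bigr => v _; rewrite mmapE mulr_sumr.
apply: eq_bigr => k1 _; rewrite raddf_sum /=.
transitivity (\sum_(k2 <- msupp y) \sum_v
   mcoeff k2 y * sort_sign u v k2 * (mcoeff k1 x * sort_sign v w k1)); last first.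
  by rewrite exchange_big; apply: eq_bigr => v _; rewrite mmapE mulr_suml.
apply: eq_bigr => k2 _; rewrite mmapU /=.
rewrite (bigD1 (sort_word k2 u)) //= [X in _ + X]big1 ?addr0; last first.
  by move=> v /negPf nv; rewrite /sort_sign eq_sym nv !mulr0 mul0r.
rewrite /sort_sign eqxx fmM size_cat exprD /sort_word foldr_cat mulr1.
ring.
Qed.

Lemma sort_coefZ u w c (x : F) : sort_coef u w (c *: x) = c * sort_coef u w x.
Proof.
rewrite /sort_coef (mmapEw (msuppZ_le c x)) mmapE mulr_sumr.
by apply: eq_bigr => m _; rewrite /= mcoeffZ -mulrA.
Qed.

Lemma sort_coef0_ideal :
  two_sided_ideal (fun x : F => forall u w, sort_coef u w x = 0).
Proof.
split=> [u w|x y x0 y0 u w|a x x0 u w|a x x0 u w].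
- exact: raddf0.
- by rewrite sort_coefB x0 y0 subr0.
- by rewrite sort_coefM big1 // => v _; rewrite x0 mul0r.
- by rewrite sort_coefM big1 // => v _; rewrite x0 mulr0.
Qed.

Lemma free_word1 i : fgen K i = free_word [:: i].
Proof. by rewrite free_word_cons free_word_nil mulr1. Qed.

Lemma sort_coef_relator (x : F) u w : hecke_relator x -> sort_coef u w x = 0.
Proof.
have E (y : F) r : y = free_word r ->
    sort_coef u w y = (-1) ^+ size r * (sort_word r u == w)%:R.
  by move=> ->; exact: sort_coef_word.
have M2 i j : fgen K i * fgen K j = free_word [:: i; j].
  by rewrite !free_word_cons free_word_nil mulr1.
have M3 i j k : fgen K i * fgen K j * fgen K k = free_word [:: i; j; k].
  by rewrite !free_word_cons free_word_nil mulr1 mulrA.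
case=> [i|i j ij|i j ij].
- apply: etrans (sort_coefD _ _ _ _) _.
  apply: etrans (congr2 +%R (E _ _ (M2 i i)) (E _ _ (free_word1 i))) _.
  rewrite /= sort_step_idem.
  by rewrite expr2 mulrNN mulr1 mul1r expr1 mulN1r subrr.
- apply: etrans (sort_coefB _ _ _ _) _.
  apply: etrans (congr2 (fun a b => a - b) (E _ _ (M3 i j i)) (E _ _ (M3 j i j))) _.
  by rewrite /= sort_step_braid // subrr.
- apply: etrans (sort_coefB _ _ _ _) _.
  apply: etrans (congr2 (fun a b => a - b) (E _ _ (M2 i j)) (E _ _ (M2 j i))) _.
  by rewrite /= sort_step_comm // subrr.
Qed.

(** Evaluate on the basis vector [1]: there [T w] acts as [w] up to sign. *)
Lemma hecke_comb_inj (a b : 'S_n -> K) : hecke_comb a = hecke_comb b -> a =1 b.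
Proof.
move=> ab w0; have [r rP] := choice (@reduced_exists n).
have combE c : hecke_comb c = \pi_H (\sum_w c w *: free_word (r w)).
  rewrite hecke_pi_sum; apply: eq_bigr => w _.
  by rewrite hecke_piZ pi_free_word (hecke_TE (rP w)).
move: ab; rewrite !combE => /hecke_pi_eq /(_ _ sort_coef0_ideal) I0.
have := I0 (fun y rel u w => sort_coef_relator u w rel) 1%g w0.
rewrite -sumrB /sort_coef raddf_sum /= (bigD1 w0) //= big1 => [|w nw].
  rewrite addr0 -scalerBl -/(sort_coef _ _ _) sort_coefZ sort_coef_word.
  rewrite (sort_word_reduced (rP w0)) eqxx mulr1 => /eqP.
  by rewrite mulf_eq0 signr_eq0 orbF subr_eq0 => /eqP.
rewrite -scalerBl -/(sort_coef _ _ _) sort_coefZ sort_coef_word.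
by rewrite (sort_word_reduced (rP w)) (negPf nw) !mulr0.
Qed.

(* The three premises say that [s_i v s_i] is longer than [v] by 2. *)
Definition central_fun (a : 'S_n -> K) : Prop := forall v i,
  ~~ ldesc v i -> ~~ rdesc v i -> (s i * v * s i != v)%g ->
  a (v * s i)%g = a v /\ a (s i * v)%g = a v.

Lemma hecke_gen_scale_T i k w :
  g i * (k *: T w) = k *: (if ldesc w i then - T w else T (w * s i)%g).
Proof. by rewrite -scalerAr hecke_mul_gen_T. Qed.

Lemma hecke_scale_T_gen i k w :
  k *: T w * g i = k *: (if rdesc w i then - T w else T (s i * w)%g).
Proof. by rewrite -scalerAl hecke_mul_T_gen. Qed.

(** Multiplication sends both members of a pair [w], [w * s i] to multiples of [T] of the longer
    one, so only coefficients at descents survive. *)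
Lemma hecke_gen_comb i a : g i * hecke_comb a =
  hecke_comb (fun w => if ldesc w i then a (w * s i)%g - a w else 0).
Proof.
rewrite /hecke_comb mulr_sumr (bigID (fun w => ldesc w i)) /=.
rewrite [in RHS](bigID (fun w => ldesc w i)) /= [X in _ = _ + X]big1 ?addr0; last first.
  by move=> w /negPf ->; rewrite scale0r.
rewrite [X in _ + X](reindex_inj (mulIg (s i))) /=.
under [X in _ + X]eq_bigl => w do rewrite ldesc_mulr negbK.
rewrite -big_split; apply: eq_bigr => w wi /=.
apply: etrans (congr2 +%R (hecke_gen_scale_T _ _ _) (hecke_gen_scale_T _ _ _)) _.
rewrite ldesc_mulr wi /= cox_mulrK.
by rewrite scalerN addrC scalerBl.
Qed.

Lemma hecke_comb_gen i a : hecke_comb a * g i =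
  hecke_comb (fun w => if rdesc w i then a (s i * w)%g - a w else 0).
Proof.
rewrite /hecke_comb mulr_suml (bigID (fun w => rdesc w i)) /=.
rewrite [in RHS](bigID (fun w => rdesc w i)) /= [X in _ = _ + X]big1 ?addr0; last first.
  by move=> w /negPf ->; rewrite scale0r.
rewrite [X in _ + X](reindex_inj (mulgI (s i))) /=.
under [X in _ + X]eq_bigl => w do rewrite rdesc_mull negbK.
rewrite -big_split; apply: eq_bigr => w wi /=.
apply: etrans (congr2 +%R (hecke_scale_T_gen _ _ _) (hecke_scale_T_gen _ _ _)) _.
rewrite rdesc_mull wi /= cox_mullK.
by rewrite scalerN addrC scalerBl.
Qed.

Lemma center_gens (z : H) : center z <-> forall i, g i * z = z * g i.
Proof.
split=> [zc i|zc x]; first exact: esym (zc _).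
have zc_word r : GRing.comm z (hecke_word r).
  by apply: commr_prod => i _; exact: esym (zc i).
have [a ->] := hecke_comb_exists x.
apply: commr_sum => w _; have [r rr] := reduced_exists w.
by rewrite (hecke_TE rr) /GRing.comm -scalerAr -scalerAl zc_word.
Qed.

(* The remaining case of the coefficient comparison: if [s_i w] and [w s_i]   *)
(* are both shorter than [w] then either they agree, or [v := s_i w s_i] is   *)
(* as in [central_fun].                                                       *)
Lemma center_combP (a : 'S_n -> K) : center (hecke_comb a) <-> central_fun a.
Proof.
rewrite center_gens; split=> [ac v i vl vr neq|ac i].
  have E := hecke_comb_inj
    (etrans (esym (hecke_gen_comb i a)) (etrans (ac i) (hecke_comb_gen i a))).
  move: (E (v * s i)%g) (E (s i * v)%g).
  rewrite ldesc_mulr rdesc_mulr // ldesc_mull // rdesc_mull vl (negPf vr) (negPf vl).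
  rewrite cox_mulrK cox_mullK /= => /eqP + /esym/eqP.
  by rewrite !subr_eq0 => /eqP -> /eqP ->.
apply: etrans (hecke_gen_comb _ _) (etrans _ (esym (hecke_comb_gen _ _))).
apply: eq_bigr => w _; apply: (congr1 (fun c => c *: T w)).
have [e|neq] := eqVneq (s i * w * s i)%g w.
  by rewrite (conj_eq_desc e) -{2}e cox_mulrK.
have [wl|wl] := boolP (ldesc w i); have [wr|wr] := boolP (rdesc w i) => //.
- have [||| e1 e2] := ac (s i * w * s i)%g i.
  + by rewrite ldesc_mulr ldesc_mull // wl.
  + by rewrite -mulgA rdesc_mull rdesc_mulr // wr.
  + by rewrite conj_conj_neq.
  by move: e1 e2; rewrite cox_mulrK -[(_ * w * _)%g]mulgA cox_mullK => -> ->.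
- have [||| e1 _] := ac (w * s i)%g i.
  + by rewrite ldesc_mulr wl.
  + by rewrite rdesc_mulr.
  + by rewrite conj_mulr_neq.
  by move: e1; rewrite cox_mulrK => ->; rewrite subrr.
- have [||| _ e2] := ac (s i * w)%g i.
  + by rewrite ldesc_mull.
  + by rewrite rdesc_mull wr.
  + by rewrite conj_mull_neq.
  by move: e2; rewrite cox_mullK => ->; rewrite subrr.
Qed.

End Hecke.

(** * Terminal elements and the center *)

Section Approx.
Local Open Scope group_scope.
Variable n : nat.
Implicit Types (w u v : 'S_n) (i j : 'I_n.-1).
Local Notation s := (@cox_gen n).
Local Notation len := (@cox_len n).

Lemma conj_stepP w w' :
  reflect (exists2 i, w' = s i * w * s i & (len w' <= len w)%N) (conj_step w w').
Proof.
apply: (iffP existsP) => [[i /andP[/eqP -> le]]|[i -> le]]; exists i => //.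
by rewrite /comp_perm eqxx.
Qed.

Lemma conj_step_sym w w' : conj_step w w' -> len w' = len w -> conj_step w' w.
Proof.
move=> /conj_stepP[i -> _] e; apply/conj_stepP; exists i; last by rewrite e.
by rewrite mulgA cox_mulrK cox_mullK.
Qed.

Lemma connect_len w w' : connect (@conj_step n) w w' -> (len w' <= len w)%N.
Proof.
case/connectP => p; elim: p w => [|x p IH] w /= => [_ -> //|/andP[wx px] e].
by apply: leq_trans (IH _ px e) _; case/conj_stepP: wx.
Qed.

Lemma approx_refl w : approx w w.
Proof. by rewrite /approx connect0. Qed.

Lemma approx_sym w w' : approx w w' = approx w' w.
Proof. by rewrite /approx andbC. Qed.

Lemma approx_trans w1 w2 w3 : approx w1 w2 -> approx w2 w3 -> approx w1 w3.
Proof.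
move=> /andP[a1 a2] /andP[b1 b2]; apply/andP; split; first exact: connect_trans b1.
exact: connect_trans a2.
Qed.

Lemma approx_len w w' : approx w w' -> len w = len w'.
Proof.
by move=> /andP[/connect_len a /connect_len b]; apply/eqP; rewrite eqn_leq a b.
Qed.

Lemma approx_step w i : len (s i * w * s i) = len w -> approx w (s i * w * s i).
Proof.
move=> e; have st : conj_step w (s i * w * s i) by apply/conj_stepP; exists i;
  rewrite ?e.
by rewrite /approx !connect1 // conj_step_sym.
Qed.

Lemma connect_approx w w' : connect (@conj_step n) w w' -> len w' = len w -> approx w w'.
Proof.
case/connectP => p; elim: p w => [|x p IH] w /= => [_ -> _|/andP[wx px] e l].
  exact: approx_refl.
have xw' : connect (@conj_step n) x w' by apply/connectP; exists p.
have lx : len x = len w.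
  by have := connect_len xw'; have /connect_len := connect1 wx; lia.
apply: approx_trans (IH _ px e _); last by rewrite lx.
by rewrite /approx !connect1 // conj_step_sym.
Qed.

(** Steps of [conj_step] never increase length, so a path from [w'] to [w] is a climb from [w] to
    [w']. *)
Definition terminal w : Prop :=
  forall w', connect (@conj_step n) w' w -> len w' = len w.

Lemma terminal_approx w w' : terminal w -> approx w w' -> terminal w'.
Proof.
move=> tw ww' x xw'; rewrite -(approx_len ww'); apply: tw.
by apply: connect_trans xw' _; rewrite approx_sym in ww'; case/andP: ww'.
Qed.

Lemma terminal_asc w i : terminal w -> ~~ ldesc w i -> ~~ rdesc w i ->
  s i * w * s i = w.
Proof.
move=> tw wl wr; apply: contraTeq isT => neq.
have l := cox_len_conj neq; rewrite (negPf wl) (negPf wr) in l.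
have := tw (s i * w * s i); rewrite l => E.
suff /E : connect (@conj_step n) (s i * w * s i) w by lia.
apply: connect1; apply/conj_stepP; exists i; last by rewrite l; lia.
by rewrite mulgA cox_mulrK cox_mullK.
Qed.

Lemma terminal_exists w : exists2 w', connect (@conj_step n) w' w & terminal w'.
Proof.
have [x xw xmax] := @arg_maxnP _ w (fun x => connect (@conj_step n) x w) len (connect0 _ _).
exists x => // y yx; apply/eqP; rewrite eqn_leq (connect_len yx) andbT.
by apply: xmax; apply: connect_trans yx xw.
Qed.

Lemma cox_len_bound w : (len w <= n * n)%N.
Proof. by apply: leq_trans (max_card _) _; rewrite card_prod card_ord. Qed.

Lemma bruhat_up u w i : ldesc w i -> bruhat u (w * s i) -> bruhat u w.
Proof.
move=> wi; have [r rr] := reduced_exists (w * s i).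
have rir : reduced_word w (i :: r) by rewrite reduced_cons wi.
by rewrite (bruhatE _ rr) (bruhatE _ rir) /= => ->.
Qed.

(** The support of the basis element attached to the class of [w]. *)
Definition below w x : bool := [exists w' in [set y | approx y w], bruhat x w'].

Lemma belowP w x :
  reflect (exists2 w', approx w' w & bruhat x w') (below w x).
Proof.
apply: (iffP existsP) => [[w' /andP[]]|[w' aw bx]]; rewrite ?inE; first by exists w'.
by exists w'; rewrite inE aw.
Qed.

Lemma below_len w x : below w x -> (len x <= len w)%N.
Proof. by case/belowP => w' /approx_len <- /bruhat_len. Qed.

Lemma below_eq w x : below w x -> len x = len w -> approx x w.
Proof. by case/belowP => w' aw bx e;
  rewrite (bruhat_len_eq bx) // e (approx_len aw). Qed.

Lemma below_refl w : below w w.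
Proof. by apply/belowP; exists w; [exact: approx_refl|exact: bruhat_refl]. Qed.

Lemma connectV w w' :
  connect (@conj_step n) w w' -> connect (@conj_step n) w^-1 w'^-1.
Proof.
case/connectP => p; elim: p w => [|z p IH] x /= => [_ -> //|/andP[xz pz] e].
apply: connect_trans (IH _ pz e); apply: connect1.
case/conj_stepP: xz => i zE le; apply/conj_stepP; exists i; last by rewrite !cox_lenV.
by rewrite zE !invMg cox_genV mulgA.
Qed.

Lemma approxV w w' : approx w w' -> approx w^-1 w'^-1.
Proof. by move=> /andP[/connectV a /connectV b]; rewrite /approx a b. Qed.

(** Downwards this is truncation. Upwards, given [v] below [x] in the class, an element of the class
    above [v * s i] is found according to the descents of [x] at [i]; when there are none,
    terminality makes [x] commute with [s i]. *)
Lemma below_mulr w v i : terminal w -> ~~ ldesc v i -> ~~ rdesc v i ->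
  s i * v * s i != v -> below w (v * s i) = below w v.
Proof.
move=> tw vl vr neq; apply/belowP/belowP => -[x xw bx].
  have vsl : ldesc (v * s i) i by rewrite ldesc_mulr.
  by exists x => //; have := bruhat_trunc vsl bx; rewrite cox_mulrK.
have [xl|xl] := boolP (ldesc x i); first by exists x => //; exact: bruhat_ldesc.
(* Here the conjugate of [x] has the same length, so it stays in the class, and it has the left
   descent that [x] lacks. *)
have [xr|xr] := boolP (rdesc x i).
  have neqx : s i * x * s i != x.
    by apply/eqP => /conj_eq_desc; rewrite (negPf xl) xr.
  have lx := cox_len_conj neqx; rewrite (negPf xl) xr in lx.
  exists (s i * x * s i).
    by apply: approx_trans xw; rewrite approx_sym; exact: approx_step.
  have xl' : ldesc (s i * x * s i) i by rewrite ldesc_mulr ldesc_mull.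
  apply: bruhat_ldesc => //; apply: (bruhat_up xl').
  by rewrite cox_mulrK; apply: bruhat_rlower.
(* Go up to [x * s i], which lies above [v * s i], and come back on the other side: [v * s i] still
   has no right descent at [i], because [s i] does not commute with [v]. *)
have e : s i * x * s i = x.
  by apply: terminal_asc => //; apply: terminal_approx tw _; rewrite approx_sym.
have xl' : ldesc (x * s i) i by rewrite ldesc_mulr.
have sx : s i * x = x * s i by rewrite -{2}e cox_mulrK.
have xr' : rdesc (x * s i) i by rewrite -sx rdesc_mull.
exists x => //; rewrite -[x](cox_mullK i) sx; apply: bruhat_rlower => //.
  by rewrite rdesc_mulr.
by apply: bruhat_ldesc => //; apply: (bruhat_up xl'); rewrite cox_mulrK.
Qed.

Lemma belowV w x : below w^-1 x^-1 = below w x.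
Proof.
apply/belowP/belowP => -[y yw xy]; exists y^-1.
- by rewrite -[w]invgK; exact: approxV.
- by rewrite -[x]invgK; exact: bruhatV.
- exact: approxV.
- exact: bruhatV.
Qed.

Lemma terminalV w : terminal w -> terminal w^-1.
Proof.
move=> tw x xw; rewrite cox_lenV -(cox_lenV x); apply: tw.
by rewrite -[w]invgK; exact: connectV.
Qed.

Lemma below_mull w v i : terminal w -> ~~ ldesc v i -> ~~ rdesc v i ->
  s i * v * s i != v -> below w (s i * v) = below w v.
Proof.
move=> tw vl vr neq; rewrite -belowV invMg cox_genV below_mulr ?belowV //.
- exact: terminalV.
- by rewrite ldescV.
- by rewrite conjV_neq.
Qed.

End Approx.

(** * A basis of the center from representatives of the terminal classes *)

Section Basis.
Variables (K : fieldType) (n : nat).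
Implicit Types (w u v x : 'S_n).
Local Notation s := (@cox_gen n).
Local Notation len := (@cox_len n).
Local Open Scope ring_scope.
Local Notation comb := (@hecke_comb K n).

Definition below_fun w x : K := (below w x)%:R.

Lemma hecke_T_le_comb w :
  hecke_T_le K [set y | approx y w] = comb (below_fun w).
Proof.
rewrite /hecke_T_le /hecke_comb big_mkcond; apply: eq_bigr => x _.
by rewrite /below_fun /below; case: existsP => _; rewrite ?scale1r ?scale0r.
Qed.

Lemma below_fun_central w : terminal w -> central_fun (below_fun w).
Proof.
by move=> tw v i vl vr neq; rewrite /below_fun below_mulr ?below_mull.
Qed.

(* Climbing cannot leave the support of a central function at its maximal     *)
(* length: a strict step [v -> s v s] would pass through [s v], of length     *)
(* [len v + 1], where the function has the same value. *)
Lemma central_fun_climb (a : 'S_n -> K) m w w' : central_fun a ->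
    (forall x, (m < len x)%N -> a x = 0) -> len w = m -> a w != 0 ->
  connect (@conj_step n) w' w -> len w' = m /\ a w' = a w.
Proof.
move=> ac a0 lw aw /connectP[p pth e].
have {aw} : len (last w' p) = m /\ a (last w' p) != 0 by rewrite -e.
suff : len (last w' p) = m /\ a (last w' p) != 0 -> len w' = m /\ a w' = a (last w' p).
  by move=> + h => /(_ h); rewrite -e.
elim: p w' {e} pth => [x _ [] //|y p IH x /= /andP[xy py] h].
have {IH} [ly ay] := IH y py h.
rewrite -ay; have {h} ay0 : a y != 0 by rewrite ay; case: h.
case/conj_stepP: xy => i yE le.
have {yE} xE : x = (s i * y * s i)%g by rewrite yE mulgA cox_mulrK cox_mullK.
have [e|neq] := eqVneq (s i * y * s i)%g y; first by rewrite xE e.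
have l := cox_len_conj neq; rewrite xE in le *.
have [yl|yl] := boolP (ldesc y i); have [yr|yr] := boolP (rdesc y i).
- by have := ldesc_len_gt0 yl; rewrite yl yr in l; lia.
- rewrite yl (negPf yr) in l; split; first by rewrite l.
  have [||| e1 e2] := ac (y * s i)%g i.
  + by rewrite ldesc_mulr yl.
  + by rewrite rdesc_mulr.
  + by rewrite conj_mulr_neq.
  by rewrite mulgA in e2; rewrite e2 -e1 cox_mulrK.
- rewrite (negPf yl) yr in l; split; first by rewrite l.
  have [||| e1 e2] := ac (s i * y)%g i.
  + by rewrite ldesc_mull.
  + by rewrite rdesc_mull yr.
  + by rewrite conj_mull_neq.
  by rewrite e1 -e2 cox_mullK.
have [e1 _] := ac y i yl yr neq.
by move: ay0; rewrite -e1 a0 ?eqxx // cox_len_mulrE (negPf yl) ly.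
Qed.

Lemma below_fun_refl w : below_fun w w = 1.
Proof. by rewrite /below_fun below_refl. Qed.

Lemma below_fun_long w x : (len w < len x)%N -> below_fun w x = 0.
Proof.
move=> lt; rewrite /below_fun; case: (boolP (below w x)) => // /below_len.
by rewrite leqNgt lt.
Qed.

Lemma hecke_combD (a b : 'S_n -> K) :
  comb a + comb b = comb (fun x => a x + b x).
Proof.
by apply: etrans (esym (big_split _ _ _ _ _)) _; apply: eq_bigr => w _;
  rewrite scalerDl.
Qed.

Lemma hecke_combZ k (a : 'S_n -> K) : k *: comb a = comb (fun x => k * a x).
Proof.
by apply: etrans (scaler_sumr _ _ _ _) _; apply: eq_bigr => w _; rewrite scalerA.
Qed.

Lemma hecke_comb0 : comb (fun=> 0) = 0.
Proof. by apply: big1 => w _; rewrite scale0r. Qed.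

Lemma hecke_comb_sum (I : Type) (t : seq I) (f : I -> 'S_n -> K) :
  \sum_(i <- t) comb (f i) = comb (fun x => \sum_(i <- t) f i x).
Proof.
elim: t => [|i t IH].
  by rewrite big_nil -hecke_comb0; apply: eq_bigr => x _; rewrite big_nil.
rewrite big_cons IH hecke_combD; apply: eq_bigr => x _; by rewrite big_cons.
Qed.

Variables (I : eqType) (sigma : I -> 'S_n).
Hypothesis sigma_terminal : forall i, terminal (sigma i).
Hypothesis sigma_onto : forall w, terminal w -> exists i, approx w (sigma i).
Hypothesis sigma_inj : forall i j, approx (sigma i) (sigma j) -> i = j.

Local Notation b i := (below_fun (sigma i)).

(** Triangularity: treat the longest representatives first. At [sigma i] the longer ones have
    coefficient 0 by induction, and among the others only [i] itself is nonzero there. *)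
Lemma below_fun_free (t : seq I) (c : I -> K) : uniq t ->
    (forall x, \sum_(i <- t) c i * b i x = 0) ->
  forall i, i \in t -> c i = 0.
Proof.
move=> ut c0 i; have [m] := ubnP (n * n - len (sigma i)).
elim: m i => // m IH i lm it.
have := c0 (sigma i); rewrite (bigD1_seq i) //= below_fun_refl mulr1.
rewrite big1_seq ?addr0 // => j /andP[ji jt].
have [lt|le] := ltnP (len (sigma i)) (len (sigma j)).
  by rewrite IH ?mul0r //; have := cox_len_bound (sigma j); lia.
rewrite /below_fun; case: (boolP (below _ _)) => [bij|_]; last by rewrite mulr0.
have /sigma_inj e : approx (sigma i) (sigma j).
  by apply: below_eq => //; apply/eqP; rewrite eqn_leq le below_len.
by rewrite e eqxx in ji.
Qed.

Lemma below_fun_span m (a : 'S_n -> K) : central_fun a ->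
    (forall w, (m <= len w)%N -> a w = 0) ->
  exists (t : seq I) (c : I -> K), uniq t /\ forall x, a x = \sum_(i <- t) c i * b i x.
Proof.
elim: m a => [|m IHm] a ac a0.
  by exists [::], (fun=> 0); split=> // x; rewrite big_nil a0.
(* Inner induction on the number of support elements of the top length [m]. *)
have [k] := ubnP #|[set w | (len w == m) && (a w != 0)]|.
elim: k a ac a0 => // k IHk a ac a0 lk.
have [w /andP[/eqP lw aw]|top0] := pickP (fun w => (len w == m) && (a w != 0));
  last first.
  apply: IHm => // w; rewrite leq_eqVlt => /orP[/eqP e|]; last exact: a0.
  by apply/eqP/negPn/negP => aw; have := top0 w; rewrite e eqxx aw.
have tw : terminal w by move=> w' /(central_fun_climb ac a0 lw aw)[->].
have [i wi] := sigma_onto tw.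
have li : len (sigma i) = m by rewrite -(approx_len wi).
pose a' x := a x - a w * b i x.
have [||| t [c [ut tE]]] := IHk a'.
- move=> v j vl vr neq; have [e1 e2] := ac v j vl vr neq.
  have [f1 f2] := @below_fun_central _ (@sigma_terminal i) v j vl vr neq.
  by rewrite /a' e1 e2 f1 f2.
- by move=> x lx; rewrite /a' a0 // below_fun_long ?li // mulr0 subrr.
(* At length [m] the subtracted term lives on the class of [w], where [a] is constantly [a w]; so no
   new support appears there and [w] is removed. *)
- rewrite -ltnS; apply: leq_ltn_trans lk; apply: proper_card; apply/properP; split.
    apply/subsetP => x; rewrite !inE => /andP[/eqP lx]; rewrite /a' lx eqxx /=.
    apply: contraNneq => ax; rewrite ax /below_fun.
    case: (boolP (below _ _)) => [/below_eq|]; last by rewrite mulr0 subrr.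
    rewrite lx li => /(_ erefl) xi.
    have xw : approx x w by apply: approx_trans xi _; rewrite approx_sym.
    have [_ e] := central_fun_climb ac a0 lw aw (proj1 (andP xw)).
    by rewrite -e ax mul0r subrr.
  exists w; rewrite !inE lw eqxx ?aw //= /a' /below_fun.
  have -> : below (sigma i) w by apply/belowP; exists w; rewrite ?bruhat_refl.
  by rewrite mulr1 subrr eqxx.
have aE x : a x = a w * b i x + \sum_(j <- t) c j * b j x.
  by rewrite -tE /a' addrC subrK.
have [it|it] := boolP (i \in t).
  exists t, (fun j => c j + (if j == i then a w else 0)); split=> // x.
  rewrite aE (bigD1_seq i) //= [in RHS](bigD1_seq i) //= eqxx mulrDl addrCA addrA.
  congr (_ + _); apply: eq_bigr => j /negPf ->; by rewrite addr0.
exists (i :: t), (fun j => if j == i then a w else c j); split=> [|x] /=;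
  first by rewrite it.
rewrite aE big_cons eqxx; congr (_ + _); apply: eq_big_seq => j jt.
by case: eqP => // e; rewrite -e jt in it.
Qed.

Lemma below_basis :
  is_basis (@center (hecke0 K n))
    (fun i => hecke_T_le K [set y | approx y (sigma i)]).
Proof.
have combE (t : seq I) (c : I -> K) :
    \sum_(i <- t) c i *: hecke_T_le K [set y | approx y (sigma i)] =
    comb (fun x => \sum_(i <- t) c i * b i x).
  rewrite -hecke_comb_sum; apply: eq_bigr => i _.
  by rewrite hecke_T_le_comb hecke_combZ.
split=> [i|v vc|t c ut].
- by rewrite hecke_T_le_comb; apply/center_combP/below_fun_central.
- have [a vE] := hecke_comb_exists v.
  have ac : central_fun a by apply/center_combP; rewrite -vE.
  have [|t [c [_ tE]]] := @below_fun_span (n * n).+1 a ac.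
    by move=> w; have := cox_len_bound w; lia.
  by exists t, c; rewrite combE vE; apply: eq_bigr => x _; rewrite tE.
rewrite combE -hecke_comb0 => /hecke_comb_inj.
exact: below_fun_free.
Qed.

End Basis.

(** * Stair elements *)

(** The stair element of [a] acting on positions in the list [stair]: consecutive blocks are
    rotated, and positions past the end are fixed. *)
Fixpoint tau (a : seq nat) (k : nat) : nat :=
  if a is p :: a' then
    if k < p then (if k.+1 == p then 0 else k.+1) else p + tau a' (k - p)
  else k.

Lemma tau_cat a b k : tau (a ++ b) (sumn a + k) = sumn a + tau b k.
Proof.
elim: a k => [|p a IH] k //=; rewrite ifF; last by lia.
by rewrite -!addnA addKn IH.
Qed.

Lemma tau_lt a k : k < sumn a -> tau a k < sumn a.
Proof.
elim: a k => [|p a IH] k //= kp; case: ifP => [kp'|kp'].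
  by case: eqP; lia.
by have := IH (k - p); lia.
Qed.

(* The order of the entries of the list 0, n-1, 1, n-2, ... in terms of their *)
(* positions. *)
Definition slt (i j : nat) : bool := if i < j then ~~ odd i else (j < i) && odd j.

Lemma slt_total i j : i != j -> slt j i = ~~ slt i j.
Proof. by rewrite /slt; case: ltngtP => //= _ _; rewrite negbK. Qed.

Section Stair.
Variable n : nat.
Implicit Types (i j k : 'I_n).

Lemma stair_entry_lt i j : (stair_entry i < stair_entry j) = slt i j.
Proof.
have := odd_double_half i; have := odd_double_half j.
have := ltn_ord i; have := ltn_ord j.
rewrite /stair_entry /slt; case: (odd i); case: (odd j) => /=; case: (ltngtP i j); lia.
Qed.

Lemma stair_entry_inj : injective (@stair_entry n).
Proof.
move=> i j e; apply/val_inj/eqP; apply: contraT => ij.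
have := slt_total ij; rewrite -!stair_entry_lt e ltnn. by [].
Qed.

Definition stair_perm : 'S_n := perm stair_entry_inj.

Lemma stair_perm_lt i j : (stair_perm i < stair_perm j) = slt i j.
Proof. by rewrite !permE stair_entry_lt. Qed.

Lemma cycle_perm_notin (c : seq 'I_n) x : x \notin c -> cycle_perm c x = x.
Proof.
move=> xc; rewrite permE next_nth mem_undup (negPf xc). by [].
Qed.

Lemma cycle_perm_nth x0 (c : seq 'I_n) (k : nat) : uniq c -> k < size c ->
  cycle_perm c (nth x0 c k) = nth x0 c (if k.+1 == size c then 0 else k.+1).
Proof.
move=> uc kc; rewrite permE undup_id // next_nth mem_nth // index_uniq //.
case: c uc kc => // y c uc kc /=.
case: eqP => [[->]|nk]; first by rewrite nth_default.
by apply: set_nth_default; move: kc nk; rewrite /=; lia.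
Qed.

Lemma prod_cycle_notin (cs : seq (seq 'I_n)) x : x \notin flatten cs ->
  (\prod_(c <- cs) cycle_perm c)%g x = x.
Proof.
elim: cs => [|c cs IH]; first by rewrite big_nil perm1.
by rewrite big_cons permM mem_cat => /norP[xc /IH]; rewrite cycle_perm_notin.
Qed.

Lemma prod_cycle_nth x0 (a : seq nat) (t : seq 'I_n) (k : nat) :
    uniq t -> sumn a = size t -> k < size t ->
  (\prod_(c <- reshape a t) cycle_perm c)%g (nth x0 t k) = nth x0 t (tau a k).
Proof.
elim: a t k => [|p a IH] t k ut at_ kt; first by rewrite -at_ in kt.
rewrite /= big_cons permM /=.
have tE : t = take p t ++ drop p t by rewrite cat_take_drop.
have pt : p <= size t by rewrite -at_ /= leq_addr.
have sp : size (take p t) = p by rewrite size_takel.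
have sd : sumn a = size (drop p t) by rewrite size_drop -at_ /= addKn.
have fl : flatten (reshape a (drop p t)) = drop p t by apply: reshapeKr; rewrite sd.
move: (ut); rewrite {1}tE cat_uniq => /and3P[ut1 /hasPn dis ut2].
case: ifP => kp.
  rewrite -(nth_take _ kp) cycle_perm_nth ?sp //.
  have : (if k.+1 == p then 0 else k.+1) < p by case: eqP; lia.
  move: (if _ then _ else _) => m mp; rewrite prod_cycle_notin ?fl ?nth_take //.
  by apply/negP => /dis /negP; apply; rewrite -(nth_take _ mp) mem_nth // sp.
have kp' : p + (k - p) = k by lia.
have nE : nth x0 t k = nth x0 (drop p t) (k - p) by rewrite nth_drop kp'.
have kp2 : k - p < size (drop p t) by rewrite size_drop; lia.
rewrite cycle_perm_notin; first by rewrite nE IH ?nth_drop.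
by rewrite nE; apply: dis; apply: mem_nth.
Qed.

Lemma stair_elt_stair (a : seq nat) k (h : tau a k < n) : sumn a = n ->
  stair_elt n a (stair_perm k) = stair_perm (Ordinal h).
Proof.
move=> an; rewrite /stair_elt !permE.
have sz : size (stair n) = n by rewrite size_map size_enum_ord.
have us : uniq (stair n) by rewrite map_inj_uniq ?enum_uniq //; exact: stair_entry_inj.
have E (i : 'I_n) : stair_entry i = nth i (stair n) i.
  by rewrite (nth_map i) ?size_enum_ord // nth_ord_enum.
rewrite (E k) prod_cycle_nth ?sz // E /=.
by apply: set_nth_default; rewrite sz.
Qed.

(** [w] read on positions of the list [stair] instead of on values. *)
Definition unstair (w : 'S_n) : 'S_n := (stair_perm * w * stair_perm^-1)%g.

Lemma unstair_eq (w : 'S_n) k : w (stair_perm k) = stair_perm (unstair w k).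
Proof. by rewrite /unstair !permM permKV. Qed.

Lemma unstair_conj (w : 'S_n) : w = (unstair w ^ stair_perm)%g.
Proof. by rewrite /unstair conjgE !mulgA mulVg mul1g -mulgA mulVg mulg1. Qed.

Lemma unstair_elt a k : sumn a = n -> unstair (stair_elt n a) k = tau a k :> nat.
Proof.
move=> an; have h : tau a k < n by rewrite -[X in _ < X]an tau_lt // an.
have := unstair_eq (stair_elt n a) k; rewrite (stair_elt_stair h) // => /perm_inj <-.
by [].
Qed.

Lemma unstair_inj : injective unstair.
Proof. by move=> w v e; rewrite (unstair_conj w) (unstair_conj v) e. Qed.

End Stair.

(** * Climbing to a stair element *)

Section Climb.
Variable n : nat.
Implicit Types (u v w : 'S_n) (i : 'I_n.-1).
Local Notation s := (@cox_gen n).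
Local Notation len := (@cox_len n).
Local Notation X := (@stair_perm n).

Lemma climb_step w i : ~~ (ldesc w i && rdesc w i) -> conj_step (s i * w * s i)%g w.
Proof.
move=> d; apply/conj_stepP; exists i; first by rewrite mulgA cox_mulrK cox_mullK.
have [->//|neq] := eqVneq (s i * w * s i)%g w.
rewrite (cox_len_conj neq); case: (ldesc w i) d; case: (rdesc w i) => // _; lia.
Qed.

(** Treats both ends of the interval at once: the usual order as seen from the left end, the
    reversed one as seen from the right end. *)
Definition ltb (b : bool) (x y : nat) := if b then x < y else y < x.

Lemma adjacent_gen b (y z : 'I_n) : ltb b y z ->
  exists i (y' : 'I_n), [/\ y' = (if b then y.+1 else y.-1) :> nat, s i = tperm y y',
    forall w, ltb b (w^-1%g y) (w^-1%g y') -> ~~ ldesc w i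
  & forall w, ltb b (w y) (w y') -> ~~ rdesc w i].
Proof.
have := ltn_ord z; have := ltn_ord y; case: b => /= yn zn yz.
  have yn' : y < n.-1 by lia.
  exists (Ordinal yn'), (gen_hi (Ordinal yn')).
  have yE : y = gen_lo (Ordinal yn') by exact: val_inj.
  split=> // [|w|w]; first by rewrite -[LHS]/(tperm (gen_lo _) (gen_hi _)) -yE.
    by rewrite /ldesc rdescPn -yE.
  by rewrite rdescPn -yE.
have yn' : y.-1 < n.-1 by lia.
exists (Ordinal yn'), (gen_lo (Ordinal yn')).
have yE : y = gen_hi (Ordinal yn') by apply: val_inj => /=; lia.
split=> // [|w|w]; first by rewrite tpermC -[LHS]/(tperm (gen_lo _) (gen_hi _)) -yE.
  by rewrite /ldesc rdescPn -yE.
by rewrite rdescPn -yE.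
Qed.

(** The image [y] of [u] moves away from [u] to [z] by adjacent swaps. Each swap is a climb: the
    preimage [u] of [y] precedes that of its neighbour, so there is no left descent. *)
Lemma climb_move b w (u y z : 'I_n) :
    ~~ ltb b z y -> ltb b u y -> w u = y ->
    (forall t : 'I_n, ltb b y t -> ~~ ltb b z t -> ltb b u (w^-1%g t)) ->
  exists g : 'S_n, [/\ forall v : 'I_n, ltb b v y || ltb b z v -> g v = v,
    g y = z & connect (@conj_step n) (w ^ g)%g w].
Proof.
have [m] := ubnP (if b then z - y else y - z).
elim: m w y => // m IH w y ltm zy uy wuy wt.
have [<-|yz] := eqVneq y z.
  by exists 1%g; split=> [v _||]; rewrite ?perm1 ?conjg1 ?connect0.
have ltyz : ltb b y z.
  by move: yz zy; rewrite -val_eqE /=; clear; case: b => /=; lia.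
have [i [y' [y'E siE ld rd]]] := adjacent_gen ltyz.
have [uy1 uy2] : y != u /\ y' != u.
  by rewrite -!val_eqE /= y'E; clear -uy; case: b uy => /=; lia.
have su : s i u = u by rewrite siE tpermD.
have step : conj_step (s i * w * s i)%g w.
  apply: climb_step; rewrite negb_and ld // -{1}wuy permK.
  by apply: wt; rewrite ?y'E; clear -ltyz; case: b ltyz => /=; lia.
have sv (v : 'I_n) : ltb b v y || ltb b y' v -> s i v = v.
  by move=> h; rewrite siE tpermD // -val_eqE /=; clear -y'E h; case: b y'E h => /=;
    lia.
have [|||||g [g1 g2 g3]] := IH (s i * w * s i)%g y'.
- by clear -ltm y'E ltyz; case: b ltm y'E ltyz => /=; lia.
- by clear -y'E ltyz; case: b y'E ltyz => /=; lia.
- by clear -y'E uy; case: b y'E uy => /=; lia.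
- by rewrite !permM su wuy siE tpermL.
- move=> t y't zt; have yt : ltb b y t by clear -y'E y't; case: b y'E y't => /=; lia.
  rewrite !invMg !cox_genV !permM (sv t) ?y't ?orbT //.
  have := wt t yt zt; move: (w^-1%g t) => x ux.
  rewrite siE; case: tpermP => // _.
  by clear -y'E uy; case: b y'E uy => /=; lia.
exists (s i * g)%g; split=> [v h||].
- have v1 : ltb b v y || ltb b y' v.
    by clear -h y'E ltyz; case: b h y'E ltyz => /=; lia.
  rewrite permM sv // g1 //.
  by clear -h y'E ltyz; case: b h y'E ltyz => /=; lia.
- by rewrite permM siE tpermL.
apply: connect_trans (connect1 step); move: g3.
by rewrite conjgM [(w ^ s i)%g]conjgE cox_genV mulgA.
Qed.

Lemma stair_perm_ltb (j k : 'I_n) : j < k -> ltb (~~ odd j) (X j) (X k).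
Proof.
move=> jk; rewrite /ltb; case: ifP => oj; rewrite stair_perm_lt /slt;
  first by rewrite jk.
by rewrite ltnNge ltnW //= jk (negbFE oj).
Qed.

(* Building the list of cycles from the outside in: once the images of the   *)
(* first [m] positions are in place, the image of position [m] can be moved  *)
(* outwards to position [m.+1], all swaps being allowed since position [m]   *)
(* is extremal among the remaining ones. *)
Lemma climb_stair w : exists2 w', connect (@conj_step n) w' w &
  forall k : 'I_n, unstair w' k <= k.+1.
Proof.
suff: forall m, m <= n -> exists2 w', connect (@conj_step n) w' w &
    forall k : 'I_n, k < m -> unstair w' k <= k.+1.
  by move=> /(_ n (leqnn n)) [w' cw h]; exists w' => // k; apply: h.
elim=> [|m IH] mn; first by exists w; rewrite ?connect0.
have [w1 cw1 h1] := IH (ltnW mn).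
pose km := Ordinal mn.
(* If the image of position [m] is already at most [m.+1], nothing moves; otherwise it is brought to
   position [m.+1]. *)
have [le|gt] := leqP (unstair w1 km) m.+1.
  exists w1 => // k; rewrite ltnS leq_eqVlt => /orP[/eqP e|]; last exact: h1.
  by rewrite (_ : k = km) //; apply: val_inj.
have mn1 : m.+1 < n by apply: ltn_trans gt _.
pose km1 := Ordinal mn1; pose b := ~~ odd m.
have wX k : w1 (X k) = X (unstair w1 k) := unstair_eq w1 k.
have outer (k k' : 'I_n) : k <= m -> m < k' -> X k = X k' -> False.
  by move=> km_ mk' /perm_inj e; rewrite e in km_; lia.
have ltX (k : 'I_n) : m < k -> ltb b (X km) (X k) by exact: (@stair_perm_ltb km).
have ltX1 (k : 'I_n) : m.+1 < k -> ltb (~~ b) (X km1) (X k).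
  by have := @stair_perm_ltb km1 k; rewrite /= negbK.
have inner (t : 'I_n) : ltb b (X km) t -> ~~ ltb b (X km1) t -> m < X^-1%g t.
  move=> t1 t2; rewrite ltnNge; apply/negP => tm; move: t1 t2; rewrite -[t](permKV X).
  move: (X^-1%g t) tm => k; rewrite leq_eqVlt => /orP[/eqP km_|km_].
    by rewrite (_ : k = km); [rewrite /ltb; case: (b); rewrite ltnn|exact: val_inj].
  have k1 := @stair_perm_ltb k km km_.
  have k2 : ltb (~~ odd k) (X k) (X km1) by apply: stair_perm_ltb; exact: ltnW.
  by move: k1 k2; rewrite /ltb; case: (odd k); case: (b) => /=; lia.
have [||||g [g1 g2 g3]] := @climb_move b w1 (X km) (X (unstair w1 km)) (X km1).
- by have := ltX1 _ gt; case: (b) => /=; lia.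
- by apply: ltX; exact: ltn_trans gt.
- exact: wX.
- move=> t yt zt.
  have kt : m < X^-1%g t.
    apply: inner => //; have := ltX _ (ltn_trans (ltnSn m) gt).
    by move: yt; case: (b) => /=; lia.
  rewrite -[t](permKV X); set k := X^-1%g t in kt *.
  rewrite (_ : w1^-1%g (X k) = X ((unstair w1)^-1%g k)); last first.
    by apply: (@perm_inj _ w1); rewrite permKV wX permKV.
  apply: ltX; set k' := (unstair w1)^-1%g k.
  have kE : k = unstair w1 k' by rewrite permKV.
  rewrite ltn_neqAle; apply/andP; split.
    apply/eqP => k'm; have e : k' = km by exact: val_inj.
    move: yt; rewrite -[t](permKV X) -/k kE e /ltb; case: (b); by rewrite ltnn.
  by rewrite leqNgt; apply/negP => /[dup] /h1; rewrite -kE; lia.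
exists (w1 ^ g)%g; first exact: connect_trans g3 cw1.
(* The conjugating element fixes the first [m.+1] positions, so what was arranged before
   persists. *)
have g_out (k : 'I_n) : k <= m -> g (X k) = X k.
  move=> km_; apply: g1; have gtm := ltnW gt; apply: contraT => h.
  have := ltX _ gtm; have := ltX1 _ gt => h2 h3.
  have : m < X^-1%g (X k).
    apply: inner.
      by move: h h2 h3; case: (b) => /=; lia.
    by move: h; case: (b) => /=; lia.
  by rewrite permK; lia.
have ugX k : (w1 ^ g)%g (g k) = g (w1 k) by rewrite conjgE !permM permK.
move=> k; rewrite ltnS leq_eqVlt => /orP[/eqP km_|km_].
  have -> : k = km by exact: val_inj.
  suff -> : unstair (w1 ^ g)%g km = km1 by [].
  apply: (@perm_inj _ X); rewrite -unstair_eq -{1}(g_out km) // ugX wX g2.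
  by [].
have := h1 k km_; suff -> : unstair (w1 ^ g)%g k = unstair w1 k by [].
apply: (@perm_inj _ X); rewrite -unstair_eq -{1}(g_out k) ?ugX ?wX ?g_out //;
  last exact: ltnW.
by have := h1 k km_; lia.
Qed.

End Climb.

(** Let [j] be least with [f j] different from [j.+1]. The values from 1 to [j] are taken, so [f j]
    is 0 and the first block is closed; the remaining positions map among themselves, and induction
    applies. *)
Lemma tau_of_injection n (f : nat -> nat) :
    (forall k, k < n -> f k < n) -> {in gtn n &, injective f} ->
    (forall k, k < n -> f k <= k.+1) ->
  exists2 a, is_composition n a & forall k, k < n -> f k = tau a k.
Proof.
have [m] := ubnP n; elim: m n f => // m IH [|n] f lm fn fi fS.
  by exists [::].
have inj x y : x < n.+1 -> y < n.+1 -> f x = f y -> x = y by exact: fi.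
have ex : exists k, (k < n.+1) && (f k != k.+1).
  by exists n; rewrite ltnSn /=; have := fn n (ltnSn n); lia.
case: (ex_minnP ex) => j /andP[jn fj] jmin.
have fSj k : k < j -> f k = k.+1.
  move=> kj; apply/eqP; apply: contraT => nk; have := jmin k; rewrite nk andbT.
  by lia.
have fj0 : f j = 0.
  have := fS j jn; case fjE : (f j) fj => [//|k] nkj lek.
  have kj : k < j by lia.
  have : k = j by apply: inj; rewrite ?(fSj k) //; lia.
  by lia.
have fge k : j < k -> k < n.+1 -> j < f k.
  move=> jk kn; rewrite ltnNge; apply/negP => le.
  case fkE : (f k) le => [|i] le.
    by have := inj j k jn kn; rewrite fj0 fkE; lia.
  have : i = k by apply: inj; rewrite ?(fSj i) //; lia.
  by lia.
have [||||a /andP[a0 /eqP an] aE] := IH (n - j) (fun k => f (j.+1 + k) - j.+1).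
- by lia.
- move=> k kn; have kn' : j.+1 + k < n.+1 by lia.
  by have := fn _ kn'; have := fge (j.+1 + k) _ kn'; lia.
- move=> x y; rewrite !inE => xn yn e.
  have xn' : j.+1 + x < n.+1 by lia. have yn' : j.+1 + y < n.+1 by lia.
  suff : j.+1 + x = j.+1 + y by lia.
  apply: inj => //.
  by have := fge (j.+1 + x) _ xn'; have := fge (j.+1 + y) _ yn'; lia.
- move=> k kn; have kn' : j.+1 + k < n.+1 by lia.
  by have := fS _ kn'; have := fge (j.+1 + k) _ kn'; lia.
exists (j.+1 :: a); first by rewrite /is_composition /= a0 an; lia.
move=> k kn /=; rewrite ltnS leq_eqVlt eqSS; have [->//|nkj] := eqVneq k j.
case: ifP => [/fSj //|kj].
have jk : j < k by lia.
have kE : j.+1 + (k - j.+1) = k by lia.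
rewrite -aE; last by lia.
by rewrite kE; have := fge k jk kn; lia.
Qed.

Section Terminal.
Variable n : nat.
Implicit Types (u v w : 'S_n).

Lemma stair_elt_of_unstair w : (forall k : 'I_n, unstair w k <= k.+1) ->
  exists2 a, is_composition n a & w = stair_elt n a.
Proof.
move=> h; pose f k := oapp (fun o : 'I_n => val (unstair w o)) 0 (insub k).
have fE (o : 'I_n) : f o = unstair w o by rewrite /f valK.
have fO k (kn : k < n) : f k = unstair w (Ordinal kn) by rewrite -fE.
have [||| a ac aE] := @tau_of_injection n f.
- by move=> k kn; rewrite fO.
- move=> x y; rewrite !inE => xn yn; rewrite !fO => /val_inj/perm_inj e.
  by have := congr1 val e.
- by move=> k kn; rewrite fO h.
exists a => //; apply: unstair_inj; apply/permP => k; apply: val_inj.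
have /andP[_ /eqP an] := ac; rewrite /= unstair_elt // -fE aE //.
Qed.

Lemma terminal_approx_stair w : terminal w ->
  exists2 a, is_composition n a & approx w (stair_elt n a).
Proof.
move=> tw; have [w' cw /stair_elt_of_unstair[a ac w'E]] := climb_stair w.
exists a => //; rewrite -w'E approx_sym; apply: connect_approx => //.
by rewrite (tw _ cw).
Qed.

End Terminal.

Fixpoint staircase_max (a : seq nat) : bool :=
  if a is p :: a' then
    if odd p then all odd a' && sorted geq a else staircase_max a'
  else true.

Lemma maximal_partsE a : maximal_parts a = staircase_max a.
Proof.
apply/existsP/idP => [[k /and3P[]]|].
  elim: a k => [|p a IH] //= [[|k] kn] /=.
    by move=> _ /andP[-> ->] ->.
  move=> /andP[/negPf -> ev] od so; rewrite ltnS in kn.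
  by apply: (IH (Ordinal kn)).
elim: a => [|p a IH] /=; first by exists ord0.
case: ifP => op h; first by exists ord0; rewrite /= op.
have [[k kn] /and3P[ev od so]] := IH h.
have kn' : k.+1 < (size a).+2 by [].
by exists (Ordinal kn'); rewrite /= op ev od so.
Qed.

Lemma not_staircase_max a : ~~ staircase_max a ->
  exists b p q c, [/\ a = b ++ [:: p, q & c], odd p & ~~ odd q || (p < q)].
Proof.
elim: a => [|p a IH] //=; case: ifP => op; last first.
  by move=> /IH[b [p' [q [c [-> h1 h2]]]]]; exists (p :: b), p', q, c.
have [h|/IH[b [p' [q [c [-> h1 h2]]]]] _] := boolP (staircase_max a); last first.
  by exists (p :: b), p', q, c.
case: a h {IH} => [|q c] //= h nh.
exists [::], p, q, c; split=> //; case: ifP h nh => //= _ /andP[-> so].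
by rewrite so andbT -ltnNge.
Qed.

(** * Lengths of stair elements *)

(** Noninversions rather than inversions are counted: few of them involve two different cycles. *)
Definition noninversions (m : nat) (a : seq nat) : nat :=
  \sum_(i < m) \sum_(j < m) (slt i j && slt (tau a i) (tau a j)).

Lemma slt_add p i j : slt (p + i) (p + j) = if odd p then slt j i else slt i j.
Proof.
rewrite /slt !ltn_add2l !oddD; case: (odd p) => /=; case: (ltngtP i j) => //= _.
by rewrite negbK.
Qed.

Lemma slt_outer i j : i < j -> (slt i j = ~~ odd i) * (slt j i = odd i).
Proof. by move=> ij; rewrite /slt ij ltnNge ltnW. Qed.

Lemma tau_lshift p a i : i < p -> tau (p :: a) i = tau [:: p] i.
Proof. by move=> ip /=; rewrite ip. Qed.

Lemma tau_rshift p a i : tau (p :: a) (p + i) = p + tau a i.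
Proof. by rewrite /= ifF ?addKn //; lia. Qed.

Lemma tau_single p i : i < p -> tau [:: p] i = if i.+1 == p then 0 else i.+1.
Proof. by move=> ip /=; rewrite ip. Qed.

Local Arguments tau : simpl never.

(* Two positions in different cycles form a noninversion exactly when the    *)
(* outer one and its image lie on the same side, which happens only for the  *)
(* last entry of an odd cycle. *)
Lemma noninversions_cons p m a : 0 < p ->
  noninversions (p + m) (p :: a) =
    noninversions p [:: p] + odd p * m + noninversions m a.
Proof.
move=> p0; rewrite /noninversions big_split_ord /=.
under eq_bigr => i _ do rewrite big_split_ord /=.
under [X in _ + X]eq_bigr => i _ do rewrite big_split_ord /=.
rewrite !big_split /= [X in _ + (X + _)]exchange_big /=.
have eq1 : \sum_(i < p) \sum_(j < p) (slt i j && slt (tau (p :: a) i) (tau (p :: a) j))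
    = \sum_(i < p) \sum_(j < p) (slt i j && slt (tau [:: p] i) (tau [:: p] j)).
  by apply: eq_bigr => i _; apply: eq_bigr => j _; rewrite !tau_lshift.
have eq2 : \sum_(i < m) \sum_(j < m)
      (slt (p + i) (p + j) && slt (tau (p :: a) (p + i)) (tau (p :: a) (p + j)))
    = \sum_(i < m) \sum_(j < m) (slt i j && slt (tau a i) (tau a j)).
  under eq_bigr => i _ do under eq_bigr => j _ do rewrite !tau_rshift !slt_add.
  by case: (odd p) => //; rewrite exchange_big.
rewrite eq1 eq2 addnA -(addnA (\sum_(i < p) _)); congr (_ + _ + _).
rewrite -big_split /=.
transitivity (\sum_(i < p) \sum_(j < m) (odd i == odd (tau [:: p] i))).
  apply: eq_bigr => i _; rewrite -big_split; apply: eq_bigr => j _.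
  rewrite tau_rshift tau_lshift //.
  have ti : tau [:: p] i < p by have := @tau_lt [:: p] i; rewrite /= addn0; apply.
  have ij : i < p + j by apply: ltn_addr.
  have tij : tau [:: p] i < p + tau a j by apply: ltn_addr.
  rewrite !(slt_outer ij) !(slt_outer tij).
  by case: (odd i); case: (odd (tau _ _)).
under eq_bigr => i _ do rewrite sum_nat_const card_ord.
rewrite -big_distrr /= mulnC; congr (_ * m).
case: p p0 {eq1 eq2} => // q _; rewrite big_ord_recr big1 => [|i _].
  by rewrite /= tau_single // eqxx /= eqbF_neg.
have e : tau [:: q.+1] i = i.+1 by rewrite tau_single ?ifF; have := ltn_ord i; lia.
by rewrite /= e /=; case: (odd i).
Qed.

Section Lengths.
Variable n : nat.
Implicit Types w : 'S_n.

Definition noninv_len w : nat :=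
  #|[set p : 'I_n * 'I_n | (p.1 < p.2) && (w p.1 < w p.2)]|.

Lemma cox_len_noninv w :
  cox_len w + noninv_len w = #|[set p : 'I_n * 'I_n | p.1 < p.2]|.
Proof.
rewrite addnC -(cardsID [set p : 'I_n * 'I_n | w p.1 < w p.2]); congr (_ + _).
  by apply: eq_card => p; rewrite !inE.
apply: eq_card => p; rewrite !inE andbC.
case: (boolP (p.1 < p.2)) => p12; rewrite ?andbF // !andbT -leqNgt ltn_neqAle.
by case: eqP => // /val_inj/perm_inj e; rewrite e ltnn in p12.
Qed.

Lemma noninv_stair a : is_composition n a ->
  noninv_len (stair_elt n a) = noninversions n a.
Proof.
move=> /andP[_ /eqP an]; rewrite /noninversions pair_big /=.
pose f (p : 'I_n * 'I_n) := (@stair_perm n p.1, @stair_perm n p.2).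
have f_bij : bijective f.
  exists (fun p => ((@stair_perm n)^-1 p.1, (@stair_perm n)^-1 p.2))%g => -[i j];
    by rewrite /f /= ?permK ?permKV.
rewrite /noninv_len -sum1_card big_mkcond (reindex f) /=; last first.
  exact: onW_bij.
apply: eq_bigr => -[i j] _; rewrite inE /f /= stair_perm_lt !unstair_eq stair_perm_lt.
by rewrite !unstair_elt //; case: (_ && _).
Qed.

End Lengths.

Fixpoint odd_tails (a : seq nat) : nat :=
  if a is p :: a' then odd p * sumn a' + odd_tails a' else 0.

Lemma noninversionsE a : all (leq 1) a ->
  noninversions (sumn a) a =
    \sum_(p <- a) noninversions p [:: p] + odd_tails a.
Proof.
elim: a => [|p a IH] /=; first by rewrite /noninversions big_ord0 big_nil.
by move=> /andP[p0 /IH e]; rewrite noninversions_cons // e big_cons; lia.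
Qed.

(** Even parts contribute nothing themselves and, in a maximal composition, follow no odd part. *)
Lemma odd_tails_filter a : staircase_max a ->
  odd_tails a = odd_tails (filter odd a) /\ sorted geq (filter odd a).
Proof.
elim: a => //= p a IH; case op: (odd p) => /=; last first.
  by move=> /IH[e so]; rewrite e so.
by move=> /andP[/all_filterP e so]; rewrite e op.
Qed.

Lemma noninversions_perm a b n : is_composition n a -> is_composition n b ->
    staircase_max a -> staircase_max b -> perm_eq a b ->
  noninversions n a = noninversions n b.
Proof.
move=> /andP[a0 /eqP an] /andP[b0 /eqP bn] /odd_tails_filter[ta sa] /odd_tails_filter[tb sb] ab.
rewrite -{1}an -bn !noninversionsE //; congr (_ + _); first exact: perm_big.
rewrite ta tb; congr odd_tails; apply: (sorted_eq (leT := geq)) => //.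
- by move=> x y z /= h1 h2; apply: leq_trans h2 h1.
- by move=> x y /= ; lia.
- exact: perm_filter.
Qed.

Lemma stair_len_perm a b n : is_composition n a -> is_composition n b ->
    staircase_max a -> staircase_max b -> perm_eq a b ->
  cox_len (stair_elt n a) = cox_len (stair_elt n b).
Proof.
move=> ca cb ma mb ab.
have := cox_len_noninv (stair_elt n a); have := cox_len_noninv (stair_elt n b).
rewrite !noninv_stair // (noninversions_perm ca cb) // => <- /eqP.
by rewrite eqn_add2r => /eqP.
Qed.

(** * Invariants of stair elements *)

Fixpoint block (a : seq nat) (k : nat) : nat :=
  if a is p :: a' then if k < p then p else block a' (k - p) else 0.

Lemma iter_tau_block a k e : k < sumn a ->
  (iter e (tau a) k == k) = (block a k %| e).
Proof.
elim: a k e => [|p a IH] k e //= ka; case: ltnP => [kp|pk].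
  have -> : iter e (tau (p :: a)) k = (k + e) %% p.
    elim: e => [|e IHe]; first by rewrite addn0 modn_small.
    have p0 := leq_ltn_trans (leq0n k) kp.
    rewrite iterS IHe tau_lshift ?tau_single ?ltn_pmod // addnS.
    have -> : (k + e).+1 %% p = ((k + e) %% p).+1 %% p by rewrite -[in RHS]addn1 modnDml addn1.
    have := ltn_pmod (k + e) p0.
    move: ((k + e) %% p) => x xp; case: eqP => [->|nx]; first by rewrite modnn.
    by rewrite modn_small; lia.
  by rewrite -{2}(modn_small kp) -{2}(addn0 k) eqn_modDl mod0n.
have kE : k = p + (k - p) by lia.
have -> : iter e (tau (p :: a)) k = p + iter e (tau a) (k - p).
  by elim: e => [|e IHe] //; rewrite !iterS IHe tau_rshift.
by rewrite {2}kE eqn_add2l IH //; lia.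
Qed.

Lemma block_gt0 a k : all (leq 1) a -> k < sumn a -> 0 < block a k.
Proof.
elim: a k => //= p a IH k /andP[p0 a0] ka; case: (ltnP k p) => // pk.
by apply: IH => //; lia.
Qed.

Lemma sum_block a d : \sum_(k < sumn a) (block a k == d) = d * count_mem d a.
Proof.
elim: a => [|p a IH]; first by rewrite big_ord0 muln0.
rewrite /= big_split_ord /= mulnDr; congr (_ + _).
  under eq_bigr => i _ do rewrite ltn_ord.
  by rewrite sum_nat_const card_ord; case: eqP => [->|]; rewrite ?muln0.
rewrite -IH; apply: eq_bigr => i _.
by rewrite ifF ?addKn //; lia.
Qed.

Section CycleType.
Variable n : nat.
Implicit Types w g : 'S_n.

(** For positive [d], the number of points in cycles of length [d]; exponents up to [d] suffice to
    pin the period down. *)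
Definition period_count d w : nat :=
  #|[set x | [forall e : 'I_d.+1, ((w ^+ e)%g x == x) == (d %| e)]]|.

Lemma period_countJ d w g : period_count d (w ^ g)%g = period_count d w.
Proof.
rewrite /period_count -[RHS](card_imset _ (@perm_inj _ g)); apply: eq_card => x.
rewrite -[x](permKV g) (mem_imset _ _ (@perm_inj _ g)) !inE.
apply: eq_forallb => e; congr (_ == _).
by rewrite -conjXg conjgE !permM permK (inj_eq perm_inj).
Qed.

Lemma connect_conjg w w' : connect (@conj_step n) w w' -> exists g, w' = (w ^ g)%g.
Proof.
case/connectP => p; elim: p w => [|x p IH] w /=; first by exists 1%g; rewrite conjg1.
move=> /andP[/conj_stepP[i -> _] px] /(IH _ px)[g ->].
by exists (cox_gen i * g)%g; rewrite conjgM [(w ^ cox_gen i)%g]conjgE cox_genV mulgA.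
Qed.

Lemma period_count_stair a d : 0 < d -> is_composition n a ->
  period_count d (stair_elt n a) = d * count_mem d a.
Proof.
move=> d0 /andP[a0 /eqP an]; rewrite (unstair_conj (stair_elt n a)) period_countJ.
rewrite -sum_block /period_count -sum1_card big_mkcond /= an.
apply: eq_bigr => k _; rewrite inE.
have ka : k < sumn a by rewrite an.
have it e : (((unstair (stair_elt n a)) ^+ e)%g k == k) = (block a k %| e).
  rewrite -iter_tau_block // permX -val_eqE /=; congr (_ == _).
  by elim: e => //= e IH; rewrite unstair_elt // IH.
have b0 : 0 < block a k by apply: block_gt0.
have [bd|nbd] := eqVneq (block a k) d.
  by rewrite ifT //; apply/forallP => e; rewrite it bd.
rewrite ifF //; apply/negP => /forallP h; case/eqP: nbd; apply/eqP.
have := h ord_max; rewrite /= it dvdnn => /eqP bd.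
have bd' : block a k < d.+1 by rewrite ltnS dvdn_leq.
have := h (Ordinal bd'); rewrite /= it dvdnn => /eqP db.
by rewrite eqn_dvd bd -db.
Qed.

Lemma stair_conj_perm_eq a b g : is_composition n a -> is_composition n b ->
  stair_elt n b = (stair_elt n a ^ g)%g -> perm_eq a b.
Proof.
move=> ca cb e; apply/allP => d _ /=; apply/eqP.
have [->|d0] := posnP d.
  have c0 (c : seq nat) : is_composition n c -> count_mem 0 c = 0.
    move=> /andP[/allP c0 _]; apply/count_memPn/negP => /c0. by [].
  by rewrite (c0 a) ?(c0 b).
apply/eqP; rewrite -(eqn_pmul2l d0) -!period_count_stair //.
by rewrite e period_countJ.
Qed.

(* The central symmetric windows exchanged with their reflection by [w]. *)
Definition swaps_ends w d : bool := [forall v : 'I_n,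
  ((v < d) == (n - d <= w v)) && ((n - d <= v) == (w v < d))].

Lemma swaps_endsP w d : reflect (forall v : 'I_n,
   (v < d) = (n - d <= w v) /\ (n - d <= v) = (w v < d)) (swaps_ends w d).
Proof.
apply: (iffP forallP) => h v; first by have /andP[/eqP -> /eqP ->] := h v.
by have [-> ->] := h v; rewrite !eqxx.
Qed.

Lemma swaps_endsV w d : swaps_ends w d -> swaps_ends w^-1%g d.
Proof.
by move=> /swaps_endsP h; apply/swaps_endsP => v; have [] := h (w^-1%g v);
  rewrite permKV => -> ->.
Qed.

(* At the boundary of an exchanged window [w] has descents on both sides, so *)
(* no length preserving conjugation crosses it. *)
Lemma swaps_ends_rdesc w d (i : 'I_n.-1) : d.*2 <= n -> swaps_ends w d ->
  (i.+1 == d) || (i.+1 == n - d) -> rdesc w i.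
Proof.
move=> dn /swaps_endsP h bi; rewrite /rdesc.
have [/= l1 l2] := h (gen_lo i); have [/= h1 h2] := h (gen_hi i).
move: l1 l2 h1 h2; have := ltn_ord i.
have := @perm_inj _ w (gen_lo i) (gen_hi i).
move: (w (gen_lo i)) (w (gen_hi i)) => x y _ ; case/orP: bi => /eqP; lia.
Qed.

Lemma swaps_ends_step w w' d : d.*2 <= n -> cox_len w' = cox_len w ->
  conj_step w w' -> swaps_ends w d -> swaps_ends w' d.
Proof.
move=> dn lw /conj_stepP[i w'E _] sw.
have [e|neq] := eqVneq (cox_gen i * w * cox_gen i)%g w; first by rewrite w'E e.
have [bi|nbi] := boolP ((i.+1 == d) || (i.+1 == n - d)).
  have ri := swaps_ends_rdesc dn sw bi.
  have li : ldesc w i := swaps_ends_rdesc dn (swaps_endsV sw) bi.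
  have := cox_len_conj neq; rewrite li ri -w'E lw.
  by have := rdesc_len_gt0 ri; case: (cox_len w) => // -[|m]; lia.
have s_end (x : 'I_n) : (cox_gen i x < d) = (x < d) /\ (n - d <= cox_gen i x) = (n - d <= x).
  by rewrite cox_genE; move: nbi; do ![case: eqP]; lia.
move/swaps_endsP: sw => sw; apply/swaps_endsP => v; rewrite w'E !permM.
have [-> ->] := s_end (w (cox_gen i v)).
have [<- <-] := sw (cox_gen i v).
by have [-> ->] := s_end v.
Qed.

Lemma swaps_ends_approx w w' d : d.*2 <= n -> approx w w' ->
  swaps_ends w d -> swaps_ends w' d.
Proof.
move=> dn aw; have lw := approx_len aw.
case/andP: aw => /connectP[p]; elim: p w lw => [|x p IH] w lw /= => [_ -> //|].
move=> /andP[wx px] e w'w sw.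
have xw' : connect (@conj_step n) x w' by apply/connectP; exists p.
have lx : cox_len x = cox_len w.
  by have := connect_len xw'; have := connect_len (connect1 wx); lia.
apply: (IH x) => //; first by rewrite lx.
  exact: connect_trans w'w (connect1 wx).
exact: swaps_ends_step wx sw.
Qed.

(** [swaps_ends] on positions: the two windows make up the first [d.*2] positions, and parity tells
    the side. *)
Definition swaps_prefix (f : nat -> nat) d : Prop :=
  forall k, k < n -> (k < d.*2) = (f k < d.*2) /\ (k < d.*2 -> odd (f k) = ~~ odd k).

Lemma stair_perm_ends d (k : 'I_n) : d.*2 <= n ->
  (@stair_perm n k < d) = (k < d.*2) && ~~ odd k /\
  (n - d <= @stair_perm n k) = (k < d.*2) && odd k.
Proof.
move=> dn; have := odd_double_half k; have := ltn_ord k.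
by rewrite permE /stair_entry; case: (odd k) => /=; lia.
Qed.

Lemma swaps_ends_stair a d : d.*2 <= n -> is_composition n a ->
  swaps_ends (stair_elt n a) d <-> swaps_prefix (tau a) d.
Proof.
move=> dn /andP[_ /eqP an]; split.
  move=> /swaps_endsP h k kn; pose ok := Ordinal kn.
  have [] := h (@stair_perm n ok); rewrite unstair_eq.
  have [-> ->] := stair_perm_ends ok dn.
  have [-> ->] := stair_perm_ends (unstair (stair_elt n a) ok) dn.
  rewrite unstair_elt //=.
  by case: (odd k); case: (odd _); case: (k < _); case: (_ < _).
move=> h; apply/swaps_endsP => v; rewrite -[v](permKV (@stair_perm n)).
move: (_ v) => k; rewrite unstair_eq.
have [-> ->] := stair_perm_ends k dn.
have [-> ->] := stair_perm_ends (unstair (stair_elt n a) k) dn.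
rewrite unstair_elt //; have [e o] := h k (ltn_ord k).
rewrite -e; case kd : (k < d.*2) => //=; rewrite o //.
by rewrite negbK.
Qed.

End CycleType.

Lemma swaps_prefix_head p a n : ~~ odd p -> 0 < p -> p + sumn a = n ->
  swaps_prefix n (tau (p :: a)) p./2.
Proof.
move=> op p0 an k kn; have pE : p./2.*2 = p by have := odd_double_half p; lia.
rewrite pE; case: (ltnP k p) => [kp|pk].
  by rewrite tau_lshift // tau_single //; case: eqP => kp'; split=> //; lia.
split=> //; apply/esym/negbTE; rewrite -leqNgt.
by rewrite -(subnKC pk) tau_rshift leq_addr.
Qed.

(** Look at the last entry of the first cycle: it maps to position 0, so it lies in the prefix and
    has odd position. *)
Lemma swaps_prefix_head_le q b n d : 0 < q -> q + sumn b = n -> 0 < d ->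
  swaps_prefix n (tau (q :: b)) d -> ~~ odd q /\ q <= d.*2.
Proof.
move=> q0 bn d0 h; have qn : q.-1 < n by lia.
have [] := h q.-1 qn; rewrite tau_lshift ?tau_single; try lia.
rewrite ifT; last by lia.
by move=> e o; have qd : q.-1 < d.*2 by [lia]; have := o qd; lia.
Qed.

Lemma swaps_prefix_cons p a n d : ~~ odd p ->
  swaps_prefix (p + n) (tau (p :: a)) (p./2 + d) <-> swaps_prefix n (tau a) d.
Proof.
move=> op; have pE : p./2.*2 = p by have := odd_double_half p; lia.
rewrite /swaps_prefix doubleD pE; split=> h k kn.
  have [|] := h (p + k); first by lia.
  by rewrite tau_rshift !ltn_add2l !oddD (negPf op) /=.
case: (ltnP k p) => [kp|pk].
  rewrite tau_lshift // tau_single //.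
  by case: eqP => kp'; split; lia.
have [k' kE] : exists k', k = p + k' by exists (k - p); lia.
have [|] := h k'; first by lia.
by rewrite kE tau_rshift !ltn_add2l !oddD (negPf op) /=.
Qed.

(** An even first part [p] makes the prefix of length [p] invariant, which forces the other first
    part to be even and at most [p]; by symmetry they agree and are stripped. Once both first parts
    are odd, both lists are sorted permutations of each other. *)
Lemma staircase_max_inj a b n : is_composition n a -> is_composition n b ->
    staircase_max a -> staircase_max b -> perm_eq a b ->
    (forall d, d.*2 <= n -> swaps_prefix n (tau a) d <-> swaps_prefix n (tau b) d) ->
  a = b.
Proof.
rewrite /is_composition => /andP[a0 /eqP an] /andP[b0 /eqP bn].
elim: a b n a0 b0 an bn => [|p a IH] [|q b] n //=.
- by move=> _ _ _ _ _ _ /perm_size.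
- by move=> _ _ _ _ _ _ /perm_size.
move=> /andP[p0 a0] /andP[q0 b0] an bn ma mb ab h.
have evenE p' a' : ~~ odd p' -> 0 < p' -> p' + sumn a' = n ->
    p'./2.*2 = p' /\ p'./2.*2 <= n /\ 0 < p'./2.
  by move=> op p0' an'; have := odd_double_half p'; lia.
have head p' a' q' b' : ~~ odd p' -> 0 < p' -> 0 < q' ->
    p' + sumn a' = n -> q' + sumn b' = n ->
    (forall d, d.*2 <= n -> swaps_prefix n (tau (p' :: a')) d -> swaps_prefix n (tau (q' :: b')) d) ->
    ~~ odd q' /\ q' <= p'.
  move=> op p0' q0' an' bn' h'; have [e [le pos]] := evenE _ _ op p0' an'.
  have := swaps_prefix_head_le q0' bn' pos (h' _ le (swaps_prefix_head op p0' an')).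
  by rewrite e.
have h1 d dn := proj1 (h d dn); have h2 d dn := proj2 (h d dn).
case: ifP ma => op ma; case: ifP mb => oq mb.
- have /andP[oa sa] := ma; have /andP[ob sb] := mb.
  apply: (sorted_eq (leT := geq)) => //.
  + by move=> x y z /= le1 le2; apply: leq_trans le2 le1.
  + by move=> x y /=; lia.
- by have [] := head q b p a (negbT oq) q0 p0 bn an h2; rewrite op.
- by have [] := head p a q b (negbT op) p0 q0 an bn h1; rewrite oq.
have [_ qp] := head p a q b (negbT op) p0 q0 an bn h1.
have [_ pq] := head q b p a (negbT oq) q0 p0 bn an h2.
have e : p = q by lia.
rewrite -e in ab bn h *; congr (_ :: _).
have nE : n = p + (n - p) by lia.
apply: (IH b (n - p)) => //; try lia.
  by move: ab; rewrite perm_cons.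
move=> d dn; have := odd_double_half p; rewrite op => pE.
have op' := negbT op.
apply: iff_trans (iff_sym (swaps_prefix_cons a (n - p) d op')) _.
apply: iff_trans _ (swaps_prefix_cons b (n - p) d op').
by rewrite -nE; apply: h; lia.
Qed.

(** * Non-maximal stair elements are not terminal *)

Section Arrangement.
Variable n : nat.
Implicit Types (t d : 'S_n).
Local Notation s := (@cox_gen n).
Local Notation X := (@stair_perm n).

(* The permutation [t] of abstract elements, with element [e] put at the     *)
(* position [d e] of the list [stair]. *)
Definition arrange t d : 'S_n := (t ^ (d * X))%g.

Lemma arrangeE t d e : arrange t d (X (d e)) = X (d (t e)).
Proof. by have := permJ t (d * X)%g e; rewrite !permM. Qed.

Lemma arrangeVE t d e : (arrange t d)^-1%g (X (d e)) = X (d (t^-1%g e)).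
Proof. by rewrite -[in LHS](permKV t e) -arrangeE permK. Qed.

Lemma arrange1 t : arrange t 1 = (t ^ X)%g.
Proof. by rewrite /arrange mul1g. Qed.

Lemma stair_perm_val (k : 'I_n) :
  X k = (if odd k then n - k./2.+1 else k./2) :> nat.
Proof. by rewrite permE /stair_entry; case: (odd k). Qed.

Lemma ltb_slt (e f : 'I_n) b : e != f -> slt e f = b -> ltb b (X e) (X f).
Proof.
move=> ef <-; rewrite /ltb; case: ifP => h; rewrite stair_perm_lt //.
by rewrite slt_total ?h // -val_eqE.
Qed.

(** Positions differing by 2 hold neighbouring values on the same side, so exchanging them is
    conjugation by one simple reflection. *)
Lemma arrange_swap t d (A B : 'I_n) : d B = (d A).+2 :> nat ->
  exists i, [/\ arrange t (d * tperm (d A) (d B)) = (s i * arrange t d * s i)%g,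
    slt (d (t A)) (d (t B)) = ~~ odd (d A) -> ~~ rdesc (arrange t d) i
  & slt (d (t^-1 A)%g) (d (t^-1 B)%g) = ~~ odd (d A) -> ~~ ldesc (arrange t d) i].
Proof.
move=> dAB; have lt : d A < d B by rewrite dAB.
have [i [y' [y'E siE ld rd]]] := adjacent_gen (stair_perm_ltb lt).
have {}y'E : y' = X (d B).
  apply: val_inj; rewrite /= y'E !stair_perm_val dAB /= negbK.
  have := odd_double_half (d A); have := ltn_ord (d B); rewrite dAB.
  by case: (odd (d A)) => /=; lia.
rewrite y'E in siE ld rd; have AB : A != B.
  by apply: contraTneq lt => ->; rewrite ltnn.
exists i; split=> [|h|h].
- rewrite /arrange -mulgA [(tperm _ _ * X)%g]conjgC tpermJ -siE mulgA conjgM.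
  by rewrite [in LHS]conjgE cox_genV mulgA.
- by apply: rd; rewrite !arrangeE; apply: ltb_slt; rewrite ?h // !(inj_eq perm_inj).
- by apply: ld; rewrite !arrangeVE; apply: ltb_slt; rewrite ?h // !(inj_eq perm_inj).
Qed.

Definition nat_perm d (x : nat) : nat := oapp (fun o => val (d o)) x (insub x).

Lemma nat_permE d (x : 'I_n) : nat_perm d x = d x.
Proof. by rewrite /nat_perm valK. Qed.

Lemma nat_perm_ord d x (h : x < n) : nat_perm d x = d (Ordinal h).
Proof. by rewrite -nat_permE. Qed.

Lemma nat_perm_lt d x : x < n -> nat_perm d x < n.
Proof. by move=> h; rewrite (nat_perm_ord d h). Qed.

Lemma nat_perm_inj d x y : x < n -> y < n -> nat_perm d x = nat_perm d y -> x = y.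
Proof.
move=> hx hy; rewrite (nat_perm_ord d hx) (nat_perm_ord d hy) => /val_inj/perm_inj e.
by have := congr1 val e.
Qed.

Lemma nat_perm_onto d y : y < n -> exists2 x, x < n & nat_perm d x = y.
Proof.
move=> h; exists (d^-1%g (Ordinal h)) => //.
by rewrite nat_permE permKV.
Qed.

Lemma nat_perm_swap d (A B : 'I_n) x : nat_perm (d * tperm (d A) (d B))%g x =
  if x == A then d B : nat else if x == B then d A : nat else nat_perm d x.
Proof.
have [h|h] := ltnP x n; last first.
  rewrite /nat_perm insubN -?leqNgt //=.
  by do 2![case: eqP => [e|_]; first by move: h; rewrite e leqNgt ltn_ord].
rewrite !(nat_perm_ord _ h) permM.
case: eqP => [xA|xA]; first by rewrite (_ : Ordinal h = A) ?tpermL //; exact: val_inj.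
case: eqP => [xB|xB]; first by rewrite (_ : Ordinal h = B) ?tpermR //; exact: val_inj.
by rewrite tpermD // (inj_eq perm_inj); apply/eqP => e; [case: xA|case: xB]; rewrite e.
Qed.

Lemma nat_perm1 x : nat_perm 1 x = x.
Proof. by rewrite /nat_perm; case: insubP => //= u _ <-; rewrite perm1. Qed.

End Arrangement.

(* Let [P] and [Q] be consecutive cycles of a stair element, the odd cycle    *)
(* [P] being outside of [Q], where [Q] is even or longer than [P]. Writing    *)
(* [P_0, P_1, ...] and [Q_0, Q_1, ...] for their entries, the last element of *)
(* [P] can be moved inwards past any [Q_j] on its side, and [P_i] can be      *)
(* moved inwards past [Q_j] once [P_(i+1)] is past [Q_(j+1)]. Doing this for  *)
(* all [j <= i + 1] ends with [P_0] passing [Q_1], which increases the length. *)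
Section BadPair.
Variables (n : nat) (pre : seq nat) (p q : nat) (post : seq nat).
Local Notation a := (pre ++ [:: p, q & post]).
Hypothesis a_comp : is_composition n a.
Hypothesis p_odd : odd p.
Hypothesis q_better : ~~ odd q || (p < q).
Local Notation m := (sumn pre).
Local Notation t := (unstair (stair_elt n a)).
Local Notation D := (@nat_perm n).
Local Notation s := (@cox_gen n).
Implicit Types d : 'S_n.

Lemma bad_pair_sum : m + p + q + sumn post = n /\ 1 < q.
Proof.
case/andP: a_comp => a0 /eqP <-; rewrite sumn_cat /=.
move: a0; rewrite all_cat /= => /and4P[_ p0 q0 _]; split; first by rewrite !addnA.
by move: q_better; lia.
Qed.

Lemma bad_pairE k : t k = tau a k :> nat.
Proof. by apply: unstair_elt; case/andP: a_comp => _ /eqP. Qed.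

Lemma bad_pair_P k : k < p -> tau a (m + k) = m + (if k.+1 == p then 0 else k.+1).
Proof. by move=> kp; rewrite tau_cat tau_lshift ?tau_single. Qed.

Lemma bad_pair_Q j : j < q ->
  tau a (m + p + j) = m + p + (if j.+1 == q then 0 else j.+1).
Proof. by move=> jq;
  rewrite -addnA tau_cat tau_rshift tau_lshift ?tau_single // addnA. Qed.

(** Invariants of the process: elements keep their side, only the two cycles move, each cycle keeps
    its order on each side, and [P_0] has not yet passed [Q_1]. *)
Definition passing d : Prop :=
  [/\ forall x, x < n -> odd (D d x) = odd x,
      forall x, x < n -> (x < m) || (m + p + q <= x) -> D d x = x,
      forall k k', k < k' -> k' < p -> odd k = odd k' -> D d (m + k) < D d (m + k'),
      forall k k', k < k' -> k' < q -> odd k = odd k' -> D d (m + p + k) < D d (m + p + k')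
    & D d m < D d (m + p + 1)].

Section Passing.
Variable d : 'S_n.
Hypothesis d_passing : passing d.

Lemma passing_block x : m <= x -> x < m + p + q -> m <= D d x < m + p + q.
Proof.
have [nE _] := bad_pair_sum; case: d_passing => _ fix_out _ _ _ mx xq.
have xn : x < n by lia.
have Dn := nat_perm_lt d xn; apply: contraT => out.
have := nat_perm_inj Dn xn (fix_out _ Dn _); lia.
Qed.

Lemma passing_onto c : m <= c -> c < m + p + q ->
  exists2 x, m <= x < m + p + q & D d x = c.
Proof.
have [nE _] := bad_pair_sum; case: d_passing => _ fix_out _ _ _ mc cq.
have [|x xn xE] := @nat_perm_onto n d c; first by lia.
exists x => //; apply: contraT => out; have := fix_out x xn; lia.
Qed.

Lemma passing_P0 : D d m = m.
Proof.
have [nE q1] := bad_pair_sum; case: (d_passing) => par _ Pinc Qinc P0Q1.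
have [|x /andP[mx xq] xE] := @passing_onto m (leqnn _); first by lia.
have ox := par x; rewrite xE in ox.
have [m_ge _] : m <= D d m /\ true by have := @passing_block m; lia.
case: (posnP (x - m)) => [x0|x0]; first by rewrite -[RHS]xE; congr (nat_perm _ _); lia.
case: (ltnP x (m + p)) => xp.
  have := Pinc 0 (x - m); rewrite addn0 subnKC // xE; lia.
have xQ : x = m + p + (x - m - p) by lia.
case: (eqVneq (x - m - p) 1) => [x1|x1].
  by move: P0Q1; rewrite -x1 -xQ xE; lia.
have := Qinc 1 (x - m - p); rewrite -xQ xE; lia.
Qed.

Definition unpassed i j : bool :=
  [&& i < p, j < q, odd i != odd j, j <= i.+1 & D d (m + i) < D d (m + p + j)].

Lemma unpassed01 : unpassed 0 1.
Proof.
have [_ q1] := bad_pair_sum; case: d_passing => _ _ _ _ P0Q1.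
by rewrite /unpassed addn0 P0Q1 q1 odd_gt0.
Qed.

Lemma unpassed_pick : exists i j, [/\ unpassed i j,
  forall k l, unpassed k l -> k <= i & forall l, unpassed i l -> j <= l].
Proof.
pose row i := has (unpassed i) (iota 0 q).
have rowP i l : unpassed i l -> row i.
  by move=> u; apply/hasP; exists l => //; rewrite mem_iota; case/and3P: u.
have ex_row : exists i, row i by exists 0; apply: rowP unpassed01.
have row_le i : row i -> i <= p by case/hasP => l _ /andP[/ltnW].
case: (ex_maxnP ex_row row_le) => i /hasP[l _ il] imax.
case: (ex_minnP (ex_intro _ l il)) => j ij jmin.
by exists i, j; split=> // k l' /rowP /imax.
Qed.

Variables i j : nat.
Hypothesis ij : unpassed i j.
Hypothesis i_max : forall k l, unpassed k l -> k <= i.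
Hypothesis j_min : forall l, unpassed i l -> j <= l.

(** An element on the same side between [P_i] and [Q_j] would be a later [P_k], against the
    maximality of [i], or an earlier [Q_k], against the minimality of [j]. *)
Lemma passing_adjacent : D d (m + p + j) = (D d (m + i)).+2.
Proof.
have [nE q1] := bad_pair_sum; case: (d_passing) => par _ Pinc Qinc _.
case/and5P: (ij) => ip jq oij ji lt.
have [Pn Qn] : m + i < n /\ m + p + j < n by clear -nE ip jq; lia.
have oPQ : odd (D d (m + p + j)) = odd (D d (m + i)).
  by rewrite !par // !oddD p_odd; case: (odd i) (odd j) (odd m) oij => [] [] [].
have /andP[mP _] : m <= D d (m + i) < m + p + q.
  by apply: passing_block; clear -ip; lia.
have /andP[_ Qq] : m <= D d (m + p + j) < m + p + q.
  by apply: passing_block; clear -jq; lia.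
apply/eqP; apply: contraT => neq.
have lt2 : (D d (m + i)).+2 < D d (m + p + j).
  have ne1 : D d (m + p + j) != (D d (m + i)).+1.
    by apply/eqP => e; move: oPQ; rewrite e /=; case: (odd _).
  by clear -lt neq ne1; lia.
have [x /andP[mx xq] xE] := @passing_onto (D d (m + i)).+2
  ltac:(clear -mP; lia) ltac:(clear -lt2 Qq; lia).
have xn : x < n by clear -xq nE; lia.
have ox : odd x = odd (m + i) by rewrite -(par x xn) xE /= negbK par.
case: (ltnP x (m + p)) => xp.
  have [k kE] : exists k, x = m + k by exists (x - m); rewrite subnKC.
  move: ox xE xp; rewrite {x mx xq xn}kE => ox xE; rewrite ltn_add2l => kp.
  have oki : odd k = odd i by move: ox; rewrite !oddD;
    case: (odd m) (odd k) (odd i) => [] [] [].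
  have ki : i < k.
    rewrite ltnNge leq_eqVlt; apply/negP => /orP[/eqP e|lt'].
      by rewrite e in xE; clear -xE; lia.
    by have := Pinc k i lt' ip oki; rewrite xE; clear; lia.
  suff /i_max : unpassed k j by rewrite leqNgt ki.
  by rewrite /unpassed kp jq oki oij xE lt2 (leq_trans ji) // ltnS ltnW.
have [k kE] : exists k, x = m + p + k by exists (x - (m + p)); rewrite subnKC.
move: ox xE xq; rewrite {x mx xp xn}kE => ox xE; rewrite ltn_add2l => kq.
have okj : odd k = odd j.
  by move: ox oij; rewrite !oddD p_odd;
    case: (odd m) (odd k) (odd i) (odd j) => [] [] [] [].
have kj : k < j.
  rewrite ltnNge leq_eqVlt; apply/negP => /orP[/eqP e|lt'].
    by rewrite -e in xE; move: lt2; rewrite xE ltnn.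
  by have := Qinc j k lt' kq (esym okj); rewrite xE; clear -lt2; lia.
suff /j_min : unpassed i k by rewrite leqNgt kj.
by rewrite /unpassed ip kq okj oij xE ltnS leqnSn (leq_trans (ltnW kj)).
Qed.

Lemma passing_ascent :
  slt (D d (tau a (m + i))) (D d (tau a (m + p + j))) = ~~ odd (D d (m + i)).
Proof.
have [nE q1] := bad_pair_sum; case: (d_passing) => par _ Pinc Qinc _.
case/and5P: (ij) => ip jq oij ji lt.
have [Pn Qn] : m + i < n /\ m + p + j < n by clear -nE ip jq; lia.
have mn : m < n by clear -nE q1; lia.
rewrite bad_pair_P // bad_pair_Q //.
set j' := if j.+1 == q then 0 else j.+1.
have jq' : j' < q by rewrite /j'; clear -jq q1; case: eqP; lia.
(* If [Q_j] is the last entry then [j] is odd, so wrapping around to [Q_0] also changes parity. This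
   is where [q] even or larger than [p] enters. *)
have ojq : j.+1 == q -> odd j.
  move=> /eqP jq1; case/orP: q_better => [|pq]; first by rewrite -jq1 /= negbK.
  have ip' : i.+1 = p by clear -ip ji jq1 pq; lia.
  by move: p_odd oij; rewrite -ip' /=; case: (odd i); case: (odd j).
have oj' : odd j' = ~~ odd j.
  by rewrite /j'; case: eqP => // /eqP /ojq ->.
have Qn' : m + p + j' < n by clear -nE jq'; lia.
have /andP[mQ _] : m <= D d (m + p + j') < m + p + q.
  by apply: passing_block; clear -jq'; lia.
have p0 := odd_gt0 p_odd.
have [e|ne] := eqVneq i.+1 p.
  have ltm : D d m < D d (m + p + j').
    rewrite ltn_neqAle passing_P0 mQ andbT -{1}passing_P0; apply/eqP => /nat_perm_inj.
    by move=> /(_ mn Qn'); clear -p0; lia.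
  rewrite addn0 (slt_outer ltm) !par // oddD.
  by move: p_odd; rewrite -e /=; case: (odd i); rewrite ?addbF.
have ip' : i.+1 < p by clear -ip ne; lia.
have Pn' : m + i.+1 < n by clear -nE ip'; lia.
have jj' : D d (m + p + j') < D d (m + i.+1).
  have : ~~ unpassed i.+1 j' by apply/negP => /i_max; rewrite ltnn.
  apply: contraNT; rewrite -leqNgt leq_eqVlt => /orP[/eqP/nat_perm_inj|lt'].
    by move=> /(_ Pn' Qn'); clear -ip'; lia.
  rewrite /unpassed ip' jq' lt' /= oj' (inj_eq negb_inj) oij /= andbT /j'.
  by case: eqP => // _; rewrite ltnS.
rewrite (slt_outer jj') !par // !oddD p_odd oj'.
by case: (odd m) (odd i) (odd j) oij => [] [] [].
Qed.

End Passing.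

Lemma slt_sides x y : odd y = ~~ odd x -> slt x y = ~~ odd x.
Proof. by rewrite /slt; case: ltngtP => // -> ; case: (odd y). Qed.

(** Swap the chosen [P_i] and [Q_j]. The sum of the positions of [P] grows, and terminality excludes
    that the pair is [P_0], [Q_1]. *)
Lemma passing_step d : terminal (stair_elt n a) ->
    passing d -> connect (@conj_step n) (arrange t d) (stair_elt n a) ->
  exists d', [/\ passing d',
    connect (@conj_step n) (arrange t d') (stair_elt n a)
  & \sum_(k < p) D d (m + k) < \sum_(k < p) D d' (m + k)].
Proof.
move=> term pd cd; have [nE q1] := bad_pair_sum.
have [i [j [ij i_max j_min]]] := unpassed_pick pd.
have adj := passing_adjacent pd ij i_max j_min.
have asc := passing_ascent pd ij i_max.
have P0 := passing_P0 pd.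
case: (pd) => par fix_out Pinc Qinc P0Q1.
case/and5P: (ij) => ip jq oij ji lt.
have An : m + i < n by clear -nE ip; lia.
have Bn : m + p + j < n by clear -nE jq; lia.
have mn : m < n by clear -An; lia.
pose A := Ordinal An; pose B := Ordinal Bn.
have dAB : d B = (d A).+2 :> nat by rewrite -!nat_permE.
have [c [E rd ld]] := arrange_swap t dAB.
set d' := (d * tperm (d A) (d B))%g in E.
have dtE (e : 'I_n) : d (t e) = D d (tau a e) :> nat by rewrite -nat_permE bad_pairE.
have {}rd : ~~ rdesc (arrange t d) c by apply: rd; rewrite !dtE asc -nat_permE.
have cd' : connect (@conj_step n) (arrange t d') (stair_elt n a).
  by apply: connect_trans cd; rewrite E connect1 // climb_step // negb_and rd orbT.
have D'E x : D d' x = if x == m + i then (D d (m + i)).+2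
    else if x == m + p + j then D d (m + i) else D d x.
  by rewrite nat_perm_swap -!nat_permE /= adj.
(* For [i = 0] the preimages, the last entry of [P] and [Q_0], lie on opposite sides in the right
   order, so there is no left descent either; terminality then forces the conjugation to be
   trivial. *)
have i0 : 0 < i.
  rewrite lt0n; apply/eqP => i0.
  have j1 : j = 1 by move: oij ji; rewrite i0; case: (j) => [|[]].
  have pE : p.-1.+1 = p by rewrite prednK // odd_gt0.
  have tP : t^-1%g A = m + p.-1 :> nat.
    have Pn : m + p.-1 < n by clear -nE pE; lia.
    suff -> : t^-1%g A = Ordinal Pn by [].
    apply: (@perm_inj _ t); rewrite permKV; apply: val_inj; rewrite /= bad_pairE /=.
    by rewrite bad_pair_P ?pE ?eqxx ?i0 //; clear -pE; lia.
  have tQ : t^-1%g B = m + p :> nat.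
    have Qn : m + p < n by clear -nE q1; lia.
    suff -> : t^-1%g B = Ordinal Qn by [].
    apply: (@perm_inj _ t); rewrite permKV; apply: val_inj; rewrite /= bad_pairE /=.
    rewrite -{2}(addn0 (m + p)) bad_pair_Q; last by clear -q1; lia.
    by rewrite j1 ifF //; clear -q1; lia.
  have op1 : odd p.-1 = false by move: p_odd; rewrite -{1}pE /=; case: odd.
  have {}ld : ~~ ldesc (arrange t d) c.
    apply: ld; rewrite -!(nat_permE d) tP tQ /= i0 addn0.
    have Pn : m + p.-1 < n by clear -nE pE; lia.
    have Qn : m + p < n by clear -nE q1; lia.
    by rewrite slt_sides !par ?oddD ?op1 ?p_odd ?addbF ?addbT.
  have ta : terminal (arrange t d).
    apply: terminal_approx (term) _; rewrite approx_sym; apply: connect_approx => //.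
    by rewrite (term _ cd).
  have := terminal_asc ta ld rd; rewrite -E => e.
  have d'A : d' A = d B by rewrite permM tpermL.
  (* A trivial conjugation would place the successor of [P_0], which lies in [P], where the
     successor of [Q_1] stood; but that successor lies in [Q] and is not [Q_1]. *)
  have := arrangeE t d' A; rewrite e d'A arrangeE => /perm_inj /(congr1 val) /=.
  have tA : (t A : nat) < m + p.
    rewrite bad_pairE /= bad_pair_P // ltn_add2l; clear -p_odd ip i0; case: eqP; lia.
  have tB : (t B : nat) = m + p + (if j.+1 == q then 0 else j.+1).
    by rewrite bad_pairE /= bad_pair_Q.
  have nej : (if j.+1 == q then 0 else j.+1) != j by clear -j1; case: (_ == q); lia.
  move: (if _ then _ else _) tB nej => l tB nej.
  have tBn : m + p + l < n by rewrite -tB ltn_ord.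
  rewrite -(nat_permE d') -(nat_permE d) D'E -adj tB.
  case: eqP => _; first by move=> e1; have := nat_perm_inj tBn Bn e1; clear -nej; lia.
  case: eqP => [h|_]; first by clear -h tA; lia.
  by move=> e1; have := nat_perm_inj tBn (ltn_ord _) e1; clear -tA; lia.
have D'n (x : nat) : (x == m + i) = false -> (x == m + p + j) = false -> D d' x = D d x.
  by move=> x1 x2; rewrite D'E x1 x2.
have PQ k l : k < p -> (m + k == m + p + l) = false by clear; lia.
have QP k l : k < p -> (m + p + l == m + k) = false by clear; lia.
exists d'; split=> //; last first.
  rewrite (bigD1 (Ordinal ip)) // [X in _ < X](bigD1 (Ordinal ip)) //= D'E eqxx.
  have -> : \sum_(l < p | l != Ordinal ip) D d' (m + l) =
            \sum_(l < p | l != Ordinal ip) D d (m + l).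
    apply: eq_bigr => l; rewrite -val_eqE /= => li.
    by rewrite D'n ?PQ // eqn_add2l (negPf li).
  by rewrite ltn_add2r.
have Dne x y : x < n -> y < n -> x != y -> D d x != D d y.
  by move=> xn yn; apply: contraNneq => /nat_perm_inj ->.
have sep x y : odd x = odd y -> x < y -> x.+2 <= y.
  by rewrite leq_eqVlt => oxy /orP[/eqP e|//]; move: oxy; rewrite -e /=; case: odd.
split.
- move=> x xn; rewrite D'E; case: eqP => [->|_]; first by rewrite /= negbK par.
  case: eqP => [->|_]; last exact: par.
  by rewrite par // !oddD p_odd; move: oij; case: (odd m) (odd i) (odd j) => [] [] [].
- move=> x xn xout; rewrite D'n ?fix_out //; clear -xout ip jq; lia.
- move=> k l kl lp okl; have kp := ltn_trans kl lp.
  have [kn ln] : m + k < n /\ m + l < n by clear -nE kp lp; lia.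
  have := Pinc k l kl lp okl; rewrite !D'E !PQ // !eqn_add2l.
  have opar : odd (D d (m + k)) = odd (D d (m + l)) by rewrite !par // !oddD okl.
  case: eqP => [ki|_]; case: eqP => [li|_] // lt'.
  + by move: kl; rewrite ki li ltnn.
  + rewrite -ki in adj *; have := sep _ _ opar lt'.
    rewrite leq_eqVlt => /orP[/eqP e|//].
    have /eqP := Dne _ _ Bn ln ltac:(by rewrite QP).
    by rewrite adj e.
  + by rewrite -li; clear -lt'; lia.
- move=> k l kl lq okl; have kq := ltn_trans kl lq.
  have [kn ln] : m + p + k < n /\ m + p + l < n by clear -nE kq lq; lia.
  have := Qinc k l kl lq okl; rewrite !D'E !QP // !eqn_add2l.
  have opar : odd (D d (m + p + k)) = odd (D d (m + p + l)) by rewrite !par // !oddD okl.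
  case: eqP => [kj|_]; case: eqP => [lj|_] // lt'.
  + by move: kl; rewrite kj lj ltnn.
  + by rewrite kj adj in lt'; clear -lt'; lia.
  + have := sep _ _ opar lt'; rewrite lj adj !ltnS leq_eqVlt => /orP[/eqP e|//].
    have /eqP := Dne _ _ kn An ltac:(by rewrite QP).
    by rewrite e.
have Q1n : m + p + 1 < n by clear -nE q1; lia.
rewrite [D d' m]D'n; last 2 first.
- by clear -i0; lia.
- by clear -ip; lia.
have gt x : m < x -> x < m + p + q -> m < D d x.
  move=> mx xq; have xn : x < n by clear -xq nE; lia.
  rewrite ltn_neqAle eq_sym -{1}P0 Dne //; last by clear -mx; lia.
  by have /andP[] := passing_block pd (ltnW mx) xq.
rewrite D'E P0 QP // eqn_add2l; case: eqP => _; apply: gt; clear -i0 ip q1; lia.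
Qed.

Lemma bad_pair_not_terminal : ~ terminal (stair_elt n a).
Proof.
move=> term; have [nE q1] := bad_pair_sum.
have p1 : passing 1.
  by split=> *; rewrite ?nat_perm1 ?ltn_add2l //; clear -p_odd; lia.
(* The positions of [P] sum to at most [p * n], so the growing sum cannot continue forever. *)
suff step k d : passing d -> connect (@conj_step n) (arrange t d) (stair_elt n a) ->
    p * n - \sum_(l < p) D d (m + l) < k -> False.
  by apply: (step _ 1%g p1 _ (ltnSn _)); rewrite arrange1 -unstair_conj connect0.
elim: k d => // k IH d pd cd ltk.
have [d' [pd' cd' lt]] := passing_step term pd cd.
apply: (IH d') => //.
suff : \sum_(l < p) D d' (m + l) <= p * n by clear -ltk lt; lia.
rewrite -[X in X * n](card_ord p) -sum_nat_const; apply: leq_sum => l _.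
by apply/ltnW/nat_perm_lt; have := ltn_ord l; clear -nE; lia.
Qed.

End BadPair.

(** * Representatives of the terminal classes *)

Section Representatives.
Variable n : nat.
Implicit Types (a b : seq nat) (w : 'S_n).

Lemma terminal_staircase_max a : is_composition n a ->
  terminal (stair_elt n a) -> staircase_max a.
Proof.
move=> ca ta; apply: contraT => /not_staircase_max[pre [p [q [post [aE op hq]]]]].
by rewrite aE in ca ta; case: (bad_pair_not_terminal ca op hq).
Qed.

Lemma terminal_onto w : terminal w ->
  exists a, [/\ is_composition n a, staircase_max a & approx w (stair_elt n a)].
Proof.
move=> tw; have [a ca wa] := terminal_approx_stair tw; exists a; split=> //.
exact: terminal_staircase_max (terminal_approx tw wa).
Qed.

Lemma approx_conj w w' : approx w w' -> exists g, w' = (w ^ g)%g.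
Proof. by case/andP => /connect_conjg. Qed.

(* Climbing from [stair_elt n a] ends at some [stair_elt n b] with [b]        *)
(* maximal and of the same cycle type, hence of the same length. *)
Lemma staircase_max_terminal a : is_composition n a -> staircase_max a ->
  terminal (stair_elt n a).
Proof.
move=> ca ma; have [w cw tw] := terminal_exists (stair_elt n a).
have [b [cb mb wb]] := terminal_onto tw.
have [g gE] := connect_conjg cw; have [h hE] := approx_conj wb.
have ab : perm_eq a b.
  by apply: (stair_conj_perm_eq (g := g^-1 * h) ca cb); rewrite hE gE -conjgM mulKVg.
apply: terminal_approx (tw) (connect_approx cw _).
by rewrite (stair_len_perm ca cb ma mb ab) (approx_len wb).
Qed.

Lemma staircase_max_approx a b : is_composition n a -> is_composition n b ->
  staircase_max a -> staircase_max b ->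
  approx (stair_elt n a) (stair_elt n b) -> a = b.
Proof.
move=> ca cb ma mb ab; have [g gE] := approx_conj ab.
apply: (staircase_max_inj ca cb ma mb (stair_conj_perm_eq ca cb gE)) => d dn.
rewrite -(swaps_ends_stair dn ca) -(swaps_ends_stair dn cb).
by split; apply: swaps_ends_approx => //; rewrite approx_sym.
Qed.

End Representatives.

Theorem corollary3p7 (K : fieldType) (n : nat) (n_ge1 : (1 <= n)%N) :
  is_basis (@center (hecke0 K n))
    (fun a : max_composition n => hecke_T_le K (stair_class n a)).
Proof.
have parts (a : max_composition n) : is_composition n a /\ staircase_max a.
  by have /andP[ca] := max_partsP a; rewrite maximal_partsE.
apply: below_basis => [a|w tw|a b ab].
- by have [] := parts a; apply: staircase_max_terminal.
- have [a [ca ma wa]] := terminal_onto tw.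
  have aP : is_composition n a && maximal_parts a by rewrite ca maximal_partsE.
  by exists (MaxComposition aP).
have [[ca ma] [cb mb]] := (parts a, parts b).
by apply: val_inj; apply: staircase_max_approx ab.
Qed.
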